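(* Let $\alpha\in(0,1)$, and let $M_1^{(\alpha)}(t)\ge M_2^{(\alpha)}(t)\ge\cdots\ge 0$ be the ranked excursion heights up to time $t$ of $\alpha$-skew Brownian motion started at $0$. Fix $y\ge 0$ and $t>0$. Then for each $j=1,2,\ldots$, $$P_0\big(M_j^{(\alpha)}(t)>y\big)=\sum_{h=1}^{\infty}2\binom{h-1}{j-1}(1-2\alpha)^{h-j}(2\alpha)^j\Big(1-\Phi\big((2h-1)y/\sqrt{t}\big)\Big),$$ where $\Phi$ is the standard normal distribution function.
   Context: Let $B=\{B_t:t\ge 0\}$ be standard Brownian motion started at $0$, and let $J_1,J_2,\ldots$ be an enumeration of the excursion intervals (away from $0$) of the reflected process $\{|B_t|:t\ge0\}$. For $\alpha\in(0,1)$ let $\{A_m^{(\alpha)}\}_m$ be i.i.d. $\pm1$-valued random variables, independent of $B$, with $P(A_m^{(\alpha)}=1)=\alpha$. The $\alpha$-skew Brownian motion started at $0$ is $$B_t^{(\alpha)}=\sum_{m=1}^{\infty}\mathbf 1_{J_m}(t)\,A_m^{(\alpha)}\,|B_t|,$$ where $\mathbf 1_S$ denotes the indicator function of $S$. $P_0$ denotes probability for the process started at $0$. For $t>0$, $M_1^{(\alpha)}(t)\ge M_2^{(\alpha)}(t)\ge\cdots\ge0$ is the ranked decreasing sequence of the excursion heights $\sup_{s\in J_m\cap[0,t]}B_s^{(\alpha)}$, ranging over all $m$ such that $J_m\cap[0,t]\neq\emptyset$. A negative excursion has height zero, and the height of the final excursion is included in the ranked list even if that excursion is incomplete at time $t$.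 Conventions: $\binom{h-1}{j-1}=0$ if $h<j$ (such terms are zero), and $0^0=1$. *)

(* Defs.v *)
From HB Require Import structures.
From mathcomp Require Import all_boot all_order all_algebra.
From mathcomp Require Import all_classical all_reals all_analysis.

Set Implicit Arguments.
Unset Strict Implicit.
Unset Printing Implicit Defensive.

Import Order.TTheory GRing.Theory Num.Theory.
Import numFieldNormedType.Exports.

Local Open Scope classical_set_scope.
Local Open Scope ring_scope.

Definition sigma_generated d (T : measurableType d) (R : realType) (I : Type)
    (D : set I) (X : I -> T -> R) : set (set T) :=
  <<s \bigcup_(i in D) preimage_set_system setT (X i) measurable >>.

Definition independent_systems d (T : measurableType d) (R : realType)
    (P : probability T R) (F G : set (set T)) : Prop :=
  forall E H, F E -> G H -> (P (E `&` H) = P E * P H)%E.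

Definition mutually_independent d (T : measurableType d) (R : realType)
    (P : probability T R) (I : eqType) (X : I -> T -> R) : Prop :=
  forall (s : seq I) (C : I -> set R), uniq s ->
    (forall i, measurable (C i)) ->
    P (\bigcap_(i in [set` s]) X i @^-1` C i) =
    (\prod_(i <- s) P (X i @^-1` C i))%E.

(* Processes are indexed by all of [R], but only nonnegative times matter. *)
Record standard_brownian_motion d (T : measurableType d) (R : realType)
    (P : probability T R) (B : R -> {RV P >-> R}) : Prop := {
  bm_start : forall w, B 0 w = 0 ;
  bm_continuous : forall w, {within `[0, +oo[, continuous (fun t => B t w)} ;
  bm_independent_increments : forall t : nat -> R,
    0 <= t 0%N -> nondecreasing_seq t ->
    mutually_independent P (fun i => B (t i.+1) \- B (t i)) ;
  (* the second parameter of [normal_prob] is the standard deviation *)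
  bm_gaussian_increments : forall s t : R, 0 <= s -> s < t ->
    forall C : set R, measurable C ->
    P ((B t \- B s) @^-1` C) = normal_prob 0 (Num.sqrt (t - s)) C
}.

(* Connected components of the set of times in [0, +oo[ at which the path [b]
   is not at 0. *)
Definition excursion_intervals (R : realType) (b : R -> R) : set (set R) :=
  let U := [set s | 0 <= s /\ b s != 0] in
  [set connected_component U s | s in U].

(* Every member of [S] is listed exactly once by [J]; indices [m] with
   [J m = set0] are unused, which leaves room for paths having only finitely
   many excursions. *)
Definition enumerates (R : realType) (S : set (set R)) (J : nat -> set R) :
    Prop :=
  set_bij [set m | J m !=set0] S J.

(* [J] enumerates the excursion intervals of |B|, and is a measurable function
   of the process B alone: membership of any time in the [m]-th interval is an
   event of the sigma-algebra generated by B. *)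
Record excursion_enumeration d (T : measurableType d) (R : realType)
    (P : probability T R) (B : R -> {RV P >-> R}) (J : nat -> T -> set R) :
    Prop := {
  exc_enumerates : forall w,
    enumerates (excursion_intervals (fun s => `|B s w|)) (J ^~ w) ;
  exc_measurable : forall (m : nat) (s : R), 0 <= s ->
    sigma_generated `[0, +oo[ B [set w | J m w s]
}.

Record excursion_signs d (T : measurableType d) (R : realType)
    (P : probability T R) (alpha : R) (B : R -> {RV P >-> R})
    (A : nat -> {RV P >-> R}) : Prop := {
  sign_values : forall m w, A m w = 1 \/ A m w = -1 ;
  sign_prob : forall m, P [set w | A m w = 1] = alpha%:E ;
  sign_independent : mutually_independent P A ;
  sign_independent_bm :
    independent_systems P (sigma_generated setT A)
                          (sigma_generated `[0, +oo[ B)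
}.

(* At most one term of the series is nonzero. *)
Definition skew_brownian_motion (T : Type) (R : realType)
    (B : R -> T -> R) (J : nat -> T -> set R) (A : nat -> T -> R)
    (t : R) (w : T) : R :=
  limn (series (fun m => \1_(J m w) t * A m w * `|B t w|)).

Definition excursion_height (R : realType) (x : R -> R) (I : set R) (t : R) :
    R :=
  sup [set x s | s in I `&` `[0, t]].

(* [M 1 >= M 2 >= ... >= 0] is the ranked list of the family [h m], [D m], of
   nonnegative numbers: its positive terms are the positive members of the
   family, with multiplicity, and they are followed by zeros if there are only
   finitely many of them. The value [M 0] is irrelevant. *)
Definition ranked (R : realType) (D : set nat) (h : nat -> R) (M : nat -> R) :
    Prop :=
  [/\ forall i, (1 <= i)%N -> 0 <= M i,
      forall i j, (1 <= i)%N -> (i <= j)%N -> M j <= M i &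
      exists f : nat -> nat,
        set_bij [set i | (1 <= i)%N /\ 0 < M i] [set m | D m /\ 0 < h m] f /\
        forall i, (1 <= i)%N -> 0 < M i -> M i = h (f i)].

Definition ranked_excursion_heights (R : realType) (x : R -> R)
    (J : nat -> set R) (t : R) (M : nat -> R) : Prop :=
  ranked [set m | (J m `&` `[0, t]) !=set0]
         (fun m => excursion_height x (J m) t) M.

Definition std_normal_cdf (R : realType) (x : R) : R :=
  fine (normal_prob 0 1 `]-oo, x]).

(* Main.v *)
Require Import Defs.
From HB Require Import structures.
From mathcomp Require Import all_boot all_order all_algebra.
From mathcomp Require Import all_classical all_reals all_analysis.
From mathcomp Require Import measurable_realfun.
From mathcomp Require Import ring lra zify.

Import Order.TTheory GRing.Theory Num.Theory.
Import numFieldNormedType.Exports.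

Local Open Scope classical_set_scope.
Local Open Scope ring_scope.

Set Implicit Arguments.
Unset Strict Implicit.
Unset Printing Implicit Defensive.

(** Fix a level y > 0 and let N be the number of excursions of |B| that exceed y
    before time t. The signs of the skew process are tossed independently of B,
    so that M_j > y has probability E v(alpha, j, N), where v(a, j, n) is the
    probability of at least j heads in n tosses of a coin of bias a
    ([binomial_tail], [rank_prob_bounds]). As a function of n, v(alpha, j, n) is
    the combination sum_h c_h v(1/2, h, n), where the c_h are the coefficients
    binom(h-1,j-1) (1-2 alpha)^(h-j) (2 alpha)^j of the theorem
    ([binomial_tail_step_thinning]); the series of the c_h converges absolutely
    because |1 - 2 alpha| < 1. The theorem is therefore a consequence of the
    identity for the fair coin,

      E v(1/2, h, N) = 2 (1 - Phi ((2h-1) y / sqrt t)) = 2 P (B_t >= (2h-1) y),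

    which is a reflection principle ([mean_excursions]). Follow |B| and toss a
    fair coin for each of its excursions above y. Unfold the path into a
    Brownian motion W: while |B| is on its way from 0 to y, the coin decides the
    direction in which W moves; on the way back from y to 0, W returns after a
    tail, but after a head it is reflected and goes on by another y. The h-th
    head is seen exactly when W first reaches (2h-1) y, which happens before t
    with probability 2 P (W_t >= (2h-1) y).

    This unfolding is carried out on finite sequences of steps. The increments
    of B along the dyadic grid of [0, t] are independent and symmetric, hence
    expectations do not change when one averages over all their signs, their
    absolute values being kept ([integral_sign_average]). For the average over
    the signs, the unfolding becomes an induction on the number of steps, in
    which a value function of the walk S is compared with the probability that
    a walk with the same steps ends above some distance ([unfolding_upper],
    [unfolding_lower]). When the steps are bounded by e, a path that is within e
    of 0 may be treated as one at 0, at the price of an error 2e at each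
    return; only the first H excursions are followed, which keeps the total
    error of order H e. Then the mesh, e and 1/H tend to 0, in this order.

    To pass from the grid to the path, the event N >= k is written as the
    existence of a chain of 2k-1 times at which |B| is alternately above y and
    equal to 0. Such a chain picks one time in each of k excursions
    ([large_excursions_chain]); by continuity it may be approximated by chains
    on the grid ([grid_of_chain], [chain_of_grid]), and zeros may be replaced by
    times at which |B| is small ([chain_below_at_zero]).

    The level y = 0 is reached from y > 0 by a limit, because the distance
    between P (M_j > y) and a partial sum of the series is bounded uniformly in
    y ([thinned_series_bound], [rank_prob_approx]). *)

(** * Tails of binomial laws *)

Section BinomialTail.
Context {R : realFieldType}.
Implicit Types (a : R) (j n h k : nat).

(** The probability of at least j heads in n tosses of a coin of bias a, by
    conditioning on the first toss. *)
Fixpoint binomial_tail a j n : R :=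
  match j, n with
  | 0, _ => 1
  | _.+1, 0 => 0
  | j'.+1, n'.+1 => a * binomial_tail a j' n' + (1 - a) * binomial_tail a j n'
  end.

Lemma binomial_tail0 a n : binomial_tail a 0 n = 1.
Proof. by case: n. Qed.

Lemma binomial_tail_bound a j n : 0 <= a -> a <= 1 ->
  0 <= binomial_tail a j n <= 1.
Proof.
move=> a0 a1; elim: n j => [|n IH] [|j] /=; rewrite ?lexx ?ler01 //.
move: (IH j) (IH j.+1) => /andP[? ?] /andP[? ?]; nra.
Qed.

(** The probability that toss k shows the j-th head, which is what the tail gains
    when the number of tosses grows from k-1 to k. *)
Definition binomial_tail_step a j k : R :=
  'C(k.-1, j.-1)%:R * a ^+ j * (1 - a) ^+ (k - j).

Lemma binomial_tail_step_ge0 a j k : 0 <= a -> a <= 1 ->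
  0 <= binomial_tail_step a j k.
Proof.
by move=> a0 a1; rewrite /binomial_tail_step !mulr_ge0 ?ler0n ?exprn_ge0 // subr_ge0.
Qed.

Lemma binomial_tail_stepE a j n :
  binomial_tail a j.+1 n.+1 - binomial_tail a j.+1 n =
  binomial_tail_step a j.+1 n.+1.
Proof.
rewrite /binomial_tail_step /= subSS.
elim: n j => [|n IH] j.
  case: j => [|j] /=; first by rewrite bin0 expr0 expr1; ring.
  by rewrite /= bin_small // mulr0n; ring.
case: j => [|j].
  rewrite [LHS]/= bin0 !subn0.
  have := IH 0%N; rewrite bin0 subn0 /= => IH0.
  rewrite binomial_tail0 in IH0 *.
  rewrite !exprS; set b := binomial_tail a 1 n in IH0 *.
  transitivity ((1 - a) * (a * 1 + (1 - a) * b - b)); first by ring.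
  by rewrite IH0 expr1 expr0; ring.
have H1 := IH j; have H2 := IH j.+1.
rewrite binS natrD.
change (a * binomial_tail a j.+1 n.+1 + (1 - a) * binomial_tail a j.+2 n.+1
   - (a * binomial_tail a j.+1 n + (1 - a) * binomial_tail a j.+2 n) =
  ('C(n, j.+1)%:R + 'C(n, j)%:R) * a ^+ j.+2 * (1 - a) ^+ (n.+1 - j.+1)).
transitivity (a * (binomial_tail a j.+1 n.+1 - binomial_tail a j.+1 n) +
  (1 - a) * (binomial_tail a j.+2 n.+1 - binomial_tail a j.+2 n)); first by ring.
rewrite H1 H2 subSS.
have [jn|nj] := ltnP j n.
  rewrite (_ : (n - j = (n - j.+1).+1)%N); last lia.
  by rewrite !exprS; ring.
by rewrite (@bin_small n j.+1) // !exprS; ring.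
Qed.

Lemma binomial_tail_sum a j n :
  binomial_tail a j.+1 n = \sum_(1 <= k < n.+1) binomial_tail_step a j.+1 k.
Proof.
elim: n => [|n IH]; first by rewrite big_geq.
by rewrite big_nat_recr // -IH -binomial_tail_stepE [RHS]addrC subrK.
Qed.

Lemma binomial_tail_minn a j H N :
  binomial_tail a j.+1 (minn H N) =
  \sum_(1 <= k < H.+1) binomial_tail_step a j.+1 k * (k <= N)%:R.
Proof.
rewrite binomial_tail_sum.
rewrite [RHS](big_cat_nat (n := (minn H N).+1)) //=; last by rewrite ltnS geq_minl.
rewrite [X in _ + X]big_nat [X in _ + X]big1 ?addr0; last first.
  move=> k /andP[Hk kH]; rewrite (_ : (k <= N)%N = false) ?mulr0 //.
  by apply/negbTE; lia.
rewrite !big_nat; apply: eq_bigr => k /andP[_].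
by rewrite ltnS leq_min => /andP[_ ->]; rewrite mulr1.
Qed.

(** The coefficient of the h-th term of the series of the theorem. *)
Definition thinning_coef a j h : R :=
  'C(h.-1, j.-1)%:R * (1 - 2 * a) ^+ (h - j) * (2 * a) ^+ j.

(** By binom(k-1,h-1) binom(h-1,j-1) = binom(k-1,j-1) binom(k-j,h-j), the sum
    over h is the binomial expansion of (1 + (1 - 2a))^(k-j) = 2^(k-j) (1-a)^(k-j). *)
Lemma binomial_tail_step_thinning a j k : (0 < j)%N -> (0 < k)%N ->
  binomial_tail_step a j k =
  \sum_(1 <= h < k.+1) thinning_coef a j h * binomial_tail_step 2^-1 h k.
Proof.
case: j k => [|j] [|k] // _ _.
rewrite /binomial_tail_step /thinning_coef big_add1 big_mkord /= subSS.
have [kj|jk] := ltnP k j.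
  rewrite bin_small // mul0r mul0r big1 // => i _.
  by rewrite (@bin_small i j) ?mul0r //; have := ltn_ord i; lia.
rewrite -(big_mkord xpredT (fun i => 'C(i, j)%:R * (1 - 2 * a) ^+ (i.+1 - j.+1) *
  (2 * a) ^+ j.+1 * ('C(k, i)%:R * 2^-1 ^+ i.+1 * (1 - 2^-1) ^+ (k.+1 - i.+1)))).
rewrite (@big_cat_nat _ _ _ j) //=; last lia.
rewrite [X in _ = X + _]big_nat big1 ?add0r; last first.
  by move=> i /andP[_ ij]; rewrite bin_small // !mul0r.
rewrite -[X in \sum_(X <= _ < _) _]add0n big_addn (_ : (k.+1 - j = (k - j).+1)%N); last lia.
rewrite big_mkord.
have -> : (1 - a) ^+ (k - j) = 2^-1 ^+ (k - j) * (1 + (1 - 2 * a)) ^+ (k - j).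
  by rewrite -exprMn; congr (_ ^+ _); field.
rewrite exprDn mulr_sumr mulr_sumr; apply: eq_bigr => i _.
have ik : (i <= k - j)%N by rewrite -ltnS ltn_ord.
rewrite expr1n mul1r (_ : (i + j).+1 - j.+1 = i)%N; last lia.
have -> : (1 - 2^-1 : R) = 2^-1 by field.
rewrite -(mulr_natl ((1 - 2 * a) ^+ i)).
have -> : 'C(k, j)%:R * a ^+ j.+1 * (2^-1 ^+ (k - j) *
   ('C(k - j, i)%:R * (1 - 2 * a) ^+ i)) =
   ('C(k, j)%:R * 'C(k - j, i)%:R) * (1 - 2 * a) ^+ i *
   (a ^+ j.+1 * 2^-1 ^+ (k - j)) :> R by ring.
have -> : 'C(i + j, j)%:R * (1 - 2 * a) ^+ i * (2 * a) ^+ j.+1 *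
  ('C(k, i + j)%:R * 2^-1 ^+ (i + j).+1 * 2^-1 ^+ (k.+1 - (i + j).+1)) =
  ('C(i + j, j)%:R * 'C(k, i + j)%:R) * (1 - 2 * a) ^+ i *
   ((2 * a) ^+ j.+1 * (2^-1 ^+ (i + j).+1 * 2^-1 ^+ (k.+1 - (i + j).+1))) :> R
  by ring.
congr (_ * _ * _).
  rewrite -!natrM; congr (_%:R).
  apply/eqP; rewrite -(@eqn_pmul2r (j`! * i`! * (k - (i + j))`!)); last first.
    by rewrite !muln_gt0 !fact_gt0.
  apply/eqP; transitivity k`!.
    rewrite (_ : (k - (i + j) = (k - j) - i)%N); last lia.
    transitivity ('C(k, j) * (j`! * ('C(k - j, i) * (i`! * (k - j - i)`!))))%N.
      by ring.
    by rewrite bin_fact // bin_fact.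
  transitivity ('C(k, i + j) * ('C(i + j, j) * (j`! * (i + j - j)`!) * (k - (i + j))`!))%N.
    by rewrite bin_fact ?leq_addl // bin_fact //; lia.
  by rewrite addnK; ring.
rewrite -exprD (_ : (i + j).+1 + (k.+1 - (i + j).+1) = j.+1 + (k - j))%N; last lia.
rewrite exprD exprMn; have : (2 : R) ^+ j.+1 * 2^-1 ^+ j.+1 = 1.
  by rewrite -exprMn divff ?expr1n // pnatr_eq0.
move=> E; transitivity ((2 ^+ j.+1 * 2^-1 ^+ j.+1) * (a ^+ j.+1 * 2^-1 ^+ (k - j))).
  by rewrite E mul1r.
ring.
Qed.

End BinomialTail.

(** * Averages over the signs of a sequence of steps *)

(** The greedy count of alternations between p and q, starting with p; greedy
    choices are optimal ([alternations_greedy]), so this is the length of the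
    longest alternating subsequence. *)
Fixpoint alternations (X : Type) (p q : pred X) (s : seq X) : nat :=
  if s is x :: s' then
    if p x then (alternations q p s').+1 else alternations p q s'
  else 0.

Lemma alternations_map (X Y : Type) (f : X -> Y) (p q : pred Y) s :
  alternations p q (map f s) =
  alternations (preim f p) (preim f q) s.
Proof. by elim: s p q => //= x s IH p q; rewrite !IH. Qed.

Section SignedAverage.
Context {R : realFieldType}.
Implicit Types (F G : seq R -> R) (a l : seq R) (c d s x y : R).

Fixpoint sign_average F a : R :=
  if a is s :: a' then
    (sign_average (F \o cons s) a' + sign_average (F \o cons (- s)) a') / 2
  else F [::].

Lemma eq_sign_average F G a : (forall l, F l = G l) ->
  sign_average F a = sign_average G a.
Proof.
elim: a F G => [|s a IH] F G FG //=.
by congr (_ / 2); congr (_ + _); apply: IH => l /=.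
Qed.

Lemma sign_averageD F G a :
  sign_average (fun l => F l + G l) a = sign_average F a + sign_average G a.
Proof.
elim: a F G => [|s a IH] F G //=.
by rewrite (IH (F \o cons s) (G \o cons s)) (IH (F \o cons (- s)) (G \o cons (- s))); field.
Qed.

Lemma sign_averageZ r F a :
  sign_average (fun l => r * F l) a = r * sign_average F a.
Proof.
elim: a F => [|s a IH] F //=.
by rewrite (IH (F \o cons s)) (IH (F \o cons (- s))); field.
Qed.

Lemma sign_average_cst r a : sign_average (fun=> r) a = r.
Proof. by elim: a => [|s a IH] //=; rewrite IH; field. Qed.

Lemma le_sign_average F G a : (forall l, F l <= G l) ->
  sign_average F a <= sign_average G a.
Proof.
elim: a F G => [|s a IH] F G FG //=.
rewrite ler_pM2r ?invr_gt0 //; apply: lerD; apply: IH => l /=; exact: FG.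
Qed.

(** The proportion of sign choices for which the walk with steps a ends at c or
    beyond. *)
Definition upper_fraction c a : R :=
  sign_average (fun l => (c <= \sum_(s <- l) s)%R%:R) a.

Lemma upper_fraction_cons c s a :
  upper_fraction c (s :: a) =
  (upper_fraction (c - s) a + upper_fraction (c + s) a) / 2.
Proof.
rewrite /upper_fraction /=; congr (_ / 2); congr (_ + _);
  apply: eq_sign_average => l /=; rewrite big_cons.
- by rewrite lerBlDl.
- by rewrite -lerBlDl opprK.
Qed.

Lemma upper_fraction_le c d a : c <= d ->
  upper_fraction d a <= upper_fraction c a.
Proof.
move=> cd; apply: le_sign_average => l; rewrite ler_nat.
by case: (leP d) => // dl; rewrite (le_trans cd dl).
Qed.

Lemma upper_fraction_ge0 c a : 0 <= upper_fraction c a.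
Proof.
by rewrite -(sign_average_cst 0 a); apply: le_sign_average => l; exact: ler0n.
Qed.

Lemma upper_fraction_le1 c a : upper_fraction c a <= 1.
Proof.
rewrite -[leRHS](sign_average_cst 1 a); apply: le_sign_average => l.
by rewrite lern1 leq_b1.
Qed.

Lemma upper_fraction_norm c x a :
  upper_fraction (c - x) a + upper_fraction (c + x) a =
  upper_fraction (c - `|x|) a + upper_fraction (c + `|x|) a.
Proof. by case: (ger0P x) => _ //; rewrite addrC !opprK. Qed.

(** Symmetry of the walk: sums that are at least c and sums that are at most -d
    cover all cases when c + d <= 0. With c = d it says that a target that is not
    ahead is reached at least half of the time. *)
Lemma upper_fractionD_ge1 c d a : c + d <= 0 ->
  1 <= upper_fraction c a + upper_fraction d a.
Proof.
elim: a c d => [|s a IH] c d cd.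
  rewrite /upper_fraction /= big_nil.
  by have [c0|c0] := leP c 0; have [d0|d0] := leP d 0 => //=; lra.
rewrite !upper_fraction_cons.
have := IH (c - s) (d + s); have := IH (c + s) (d - s).
by move=> /(_ ltac:(lra)) H1 /(_ ltac:(lra)) H2; lra.
Qed.

Lemma upper_fractionD_le1 c d a : 0 < c + d ->
  upper_fraction c a + upper_fraction d a <= 1.
Proof.
elim: a c d => [|s a IH] c d cd.
  rewrite /upper_fraction /= big_nil.
  by have [c0|c0] := leP c 0; have [d0|d0] := leP d 0 => //=; lra.
rewrite !upper_fraction_cons.
have := IH (c - s) (d + s); have := IH (c + s) (d - s).
by move=> /(_ ltac:(lra)) H1 /(_ ltac:(lra)) H2; lra.
Qed.

End SignedAverage.

(** * Unfolding a random walk *)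

(** A step no longer than the distance to 0 does not change the side of 0. *)
Lemma norm_addr_small {R : realFieldType} (x b e : R) : e <= `|x| -> `|b| <= e ->
  `|x + b| = `|x| + (if 0 <= x then b else - b).
Proof.
move=> xb; rewrite ler_norml => /andP[b1 b2].
case: (leP 0 x) => [x0|x0].
  move: xb; rewrite (ger0_norm x0) => xb; rewrite ger0_norm //; lra.
move: xb; rewrite (ltr0_norm x0) => xb; rewrite ler0_norm; lra.
Qed.

Section Unfolding.
Context {R : realFieldType}.
Variables (y e : R).
Implicit Types (a l : seq R) (x s theta : R) (h H N : nat).

Definition far (x : R) := y < `|x|.
Definition near (x : R) := `|x| < e.

(** Only the first H excursions are followed. The term weighted by theta is a
    bonus for walks with H excursions or more: 0 for upper bounds; for lower
    bounds 1, which makes up for the excursions that are not followed. *)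
Definition truncated_tail theta h H N : R :=
  binomial_tail 2^-1 h (minn H N) + theta * (H <= N)%N%:R.

Lemma truncated_tailS theta h H N :
  truncated_tail theta h.+1 H.+1 N.+1 =
  (truncated_tail theta h H N + truncated_tail theta h.+1 H N) / 2.
Proof. by rewrite /truncated_tail minnSS /= ltnS; field. Qed.

(** The expected value when h heads are still wanted, H excursions may still be
    followed, the walk is at x and is on its way from 0 to the level y. *)
Definition out_value theta h H x a : R :=
  sign_average (fun l => truncated_tail theta h H
    (uphalf (alternations far near (scanl +%R x l)))) a.

(** The same when the walk is on its way from the level y back to 0. *)
Definition in_value theta h H x a : R :=
  sign_average (fun l => truncated_tail theta h H
    (half (alternations near far (scanl +%R x l)))) a.

Lemma out_value_hit theta h H x s a : far (x + s) ->
  sign_average ((fun l => truncated_tail theta h.+1 H.+1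
    (uphalf (alternations far near (scanl +%R x l)))) \o cons s) a =
  (in_value theta h H (x + s) a + in_value theta h.+1 H (x + s) a) / 2.
Proof.
move=> hit; rewrite -sign_averageD mulrC -sign_averageZ.
by apply: eq_sign_average => l /=; rewrite hit uphalfE truncated_tailS mulrC.
Qed.

Lemma out_value_miss theta h H x s a : ~~ far (x + s) ->
  sign_average ((fun l => truncated_tail theta h H
    (uphalf (alternations far near (scanl +%R x l)))) \o cons s) a =
  out_value theta h H (x + s) a.
Proof. by move=> /negbTE E; apply: eq_sign_average => l /=; rewrite E. Qed.

Lemma in_value_hit theta h H x s a : near (x + s) ->
  sign_average ((fun l => truncated_tail theta h H
    (half (alternations near far (scanl +%R x l)))) \o cons s) a =
  out_value theta h H (x + s) a.
Proof. by move=> E; apply: eq_sign_average => l /=; rewrite E. Qed.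

Lemma in_value_miss theta h H x s a : ~~ near (x + s) ->
  sign_average ((fun l => truncated_tail theta h H
    (half (alternations near far (scanl +%R x l)))) \o cons s) a =
  in_value theta h H (x + s) a.
Proof. by move=> /negbTE E; apply: eq_sign_average => l /=; rewrite E. Qed.

Lemma value_out_of_trials h x a :
  out_value 0 h.+1 0 x a = 0 /\ in_value 0 h.+1 0 x a = 0.
Proof.
split; rewrite -[RHS](sign_average_cst 0 a); apply: eq_sign_average => l;
  by rewrite /truncated_tail min0n mul0r addr0.
Qed.

Lemma in_value0 H x a : in_value 0 0 H x a = 1.
Proof.
rewrite -[RHS](sign_average_cst 1 a); apply: eq_sign_average => l.
by rewrite /truncated_tail binomial_tail0 mul0r addr0.
Qed.

Local Notation uf := upper_fraction.

(** The unfolded walk still has to cover a distance D, about (2h+1) y, to produce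
    h+1 heads. On the way out its direction is a coin toss, hence it is displaced
    by x or by -x with equal odds, and the bound is the mean of the two
    probabilities 2 P (walk >= D -+ x). On the way in it moves back by |x|. Both
    expressions are preserved by a step, since U(c, s :: a) is the mean of
    U(c - s, a) and U(c + s, a). The overshoot beyond y is favourable. D starts
    with a deduction of 2e for each excursion that may be followed; one of them is
    used up at each return, where the walk is only known to be within e of 0. *)
Lemma unfolding_upper a : 0 < e -> e <= y -> all (fun s : R => `|s| <= e) a -> forall h H (x : R),
  (`|x| <= y -> out_value 0 h.+1 H x a <=
     uf ((2 * h%:R + 1) * y - (2 * H%:R) * e - x) a +
     uf ((2 * h%:R + 1) * y - (2 * H%:R) * e + x) a) /\
  (e <= `|x| -> in_value 0 h.+1 H x a <=
     2 * uf ((2 * h%:R + 1) * y - (2 * H%:R + 2) * e + `|x|) a).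
Proof.
have uf0 c a' : 0 <= uf c a' by exact: upper_fraction_ge0.
move=> e0 ey; elim: a => [_|s a IH] => [h H x|/= /andP[sle ale] h H x].
  split => _; rewrite ?/out_value ?/in_value /= /truncated_tail minn0 /= mul0r addr0.
    by rewrite addr_ge0.
  by rewrite mulr_ge0.
have IHa := IH ale.
case: H => [|H].
  have [-> ->] := value_out_of_trials h x (s :: a).
  by split=> _; [apply: addr_ge0|apply: mulr_ge0].
have step (x' : R) : `|x'| <= y + e ->
  (if far x' then (in_value 0 h H x' a + in_value 0 h.+1 H x' a) / 2 else
    out_value 0 h.+1 H.+1 x' a) <=
   uf ((2 * h%:R + 1) * y - (2 * H.+1%:R) * e - x') a +
   uf ((2 * h%:R + 1) * y - (2 * H.+1%:R) * e + x') a.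
  move=> x'ub; rewrite /far; case: ltP => [x'y|x'y]; last exact: (IHa _ _ _).1.
  have ex' : e <= `|x'| by lra.
  set D := _ - _ * e.
  rewrite upper_fraction_norm.
  have H1 : in_value 0 h.+1 H x' a <= 2 * uf (D + `|x'|) a.
    apply: le_trans ((IHa h H x').2 ex') _.
    rewrite (_ : _ - (2 * H%:R + 2) * e = D) // /D -(natr1 H); ring.
  suff H2 : in_value 0 h H x' a <= 2 * uf (D - `|x'|) a by lra.
  case: h @D H1 => [|h] D H1.
    rewrite in_value0.
    have D0 : (D - `|x'|) + (D - `|x'|) <= 0.
      have := ler0n R H; rewrite /D -natr1; nra.
    by have := @upper_fractionD_ge1 R _ _ a D0; lra.
  apply: le_trans ((IHa h H x').2 ex') _.
  rewrite ler_pM2l //; apply: upper_fraction_le; rewrite /D -!natr1; nra.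
split=> xb.
  rewrite !upper_fraction_cons.
  have S1 : sign_average ((fun l => truncated_tail 0 h.+1 H.+1
     (uphalf (alternations far near (scanl +%R x l)))) \o cons s) a <=
      uf ((2 * h%:R + 1) * y - (2 * H.+1%:R) * e - (x + s)) a +
      uf ((2 * h%:R + 1) * y - (2 * H.+1%:R) * e + (x + s)) a.
    apply: le_trans (step _ _); last first.
      by rewrite (le_trans (ler_normD _ _)) // lerD.
    by case: ifP => E; [rewrite out_value_hit|rewrite out_value_miss ?E].
  have S2 : sign_average ((fun l => truncated_tail 0 h.+1 H.+1
     (uphalf (alternations far near (scanl +%R x l)))) \o cons (- s)) a <=
      uf ((2 * h%:R + 1) * y - (2 * H.+1%:R) * e - (x - s)) a +
      uf ((2 * h%:R + 1) * y - (2 * H.+1%:R) * e + (x - s)) a.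
    apply: le_trans (step _ _); last first.
      by rewrite (le_trans (ler_normD _ _)) // normrN lerD.
    by case: ifP => E; [rewrite out_value_hit|rewrite out_value_miss ?E].
  rewrite /out_value /=; move: S1 S2; set D := _ - _ * e.
  rewrite (_ : D - x - s = D - (x + s)); last ring.
  rewrite (_ : D - x + s = D - (x - s)); last ring.
  rewrite (_ : D + x - s = D + (x - s)); last ring.
  rewrite (_ : D + x + s = D + (x + s)); last ring.
  lra.
pose D := (2 * h%:R + 1) * y - (2 * H.+1%:R + 2) * e.
have instep (x' : R) (b : R) : b <= e -> - e <= b -> `|x'| = `|x| + b ->
  (if near x' then out_value 0 h.+1 H.+1 x' a else in_value 0 h.+1 H.+1 x' a) <=
  2 * uf (D + `|x| + b) a.
  move=> b1 b2 bx; rewrite /near; case: ltP => [nx|nx]; last first.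
    by rewrite -addrA -bx; exact: (IHa _ _ _).2.
  apply: le_trans ((IHa _ _ _).1 _) _; first lra.
  rewrite -(addrA D) -bx; set u := uf (D + `|x'|) a.
  rewrite (_ : 2 * u = u + u); last ring.
  rewrite /u; apply: lerD; apply: upper_fraction_le; rewrite /D;
    have := ler_norm x'; have := ler_norm (- x'); rewrite normrN; lra.
have norms (b : R) := norm_addr_small xb (b := b).
have sle' := sle; move: sle'; rewrite ler_norml => /andP[s1 s2].
have S1 : sign_average ((fun l => truncated_tail 0 h.+1 H.+1
   (half (alternations near far (scanl +%R x l)))) \o cons s) a <=
    2 * uf (D + `|x| + (if 0 <= x then s else - s)) a.
  apply: le_trans (instep (x + s) _ _ _ (norms s sle)); try by case: ifP => _; lra.
  by case: ifP => E; [rewrite in_value_hit|rewrite in_value_miss ?E].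
have sleN : `|- s| <= e by rewrite normrN.
have S2 : sign_average ((fun l => truncated_tail 0 h.+1 H.+1
   (half (alternations near far (scanl +%R x l)))) \o cons (- s)) a <=
    2 * uf (D + `|x| + (if 0 <= x then - s else - - s)) a.
  apply: le_trans (instep (x - s) _ _ _ (norms (- s) sleN)); try by case: ifP => _; lra.
  by case: ifP => E; [rewrite in_value_hit|rewrite in_value_miss ?E].
rewrite upper_fraction_cons -/D /in_value /=.
move: S1 S2; case: ifP => _; rewrite ?opprK; lra.
Qed.

(** The mirror image of [unfolding_upper]: here the overshoot beyond y, at most e,
    is unfavourable and uses up 2e of the margin added to D. The last 2e keep the
    target ahead of the walk, so that it is reached at most half of the time. *)
Lemma unfolding_lower a : 0 < e -> e <= y -> all (fun s : R => `|s| <= e) a ->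
  forall h H (x : R),
  (`|x| <= y ->
     uf ((2 * h%:R + 1) * y + (2 * H%:R + 2) * e - x) a +
     uf ((2 * h%:R + 1) * y + (2 * H%:R + 2) * e + x) a <=
     out_value 1 h.+1 H x a) /\
  (e <= `|x| ->
     2 * uf ((2 * h%:R + 1) * y + (2 * H%:R + 2) * e + `|x|) a <=
     in_value 1 h.+1 H x a).
Proof.
move=> e0 ey.
have y0 : 0 < y by lra.
have D_gt0 h H (b : R) : b < e -> 0 < (2 * h%:R + 1) * y + (2 * H%:R + 2) * e - y - b.
  move=> be; have : 0 <= h%:R * y by rewrite mulr_ge0 // ltW.
  have : 0 <= H%:R * e by rewrite mulr_ge0 // ltW.
  lra.
elim: a => [_|s a IH] => [h H x|/= /andP[sle ale] h H x].
  have uf_nil (c : R) : 0 < c -> uf c [::] = 0.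
    by move=> c0; rewrite /upper_fraction /= big_nil leNgt c0.
  have ge0 : 0 <= truncated_tail 1 h.+1 H 0 :> R.
    by rewrite /truncated_tail minn0 /= add0r mul1r.
  have D0 := D_gt0 h H 0 e0.
  split => xb; rewrite ?/out_value ?/in_value /=.
    move: (xb); rewrite ler_norml => /andP[x1 x2].
    rewrite !uf_nil ?addr0 //; lra.
  rewrite !uf_nil ?mulr0 //; lra.
have IHa := IH ale.
case: H => [|H].
  have one : out_value 1 h.+1 0 x (s :: a) = 1 /\ in_value 1 h.+1 0 x (s :: a) = 1.
    split; rewrite -[RHS](sign_average_cst 1 (s :: a)); apply: eq_sign_average => l;
      by rewrite /truncated_tail min0n mul1r add0r.
  have [-> ->] := one; have D0 := D_gt0 h 0 0 e0.
  split => xb.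
    apply: upper_fractionD_le1; lra.
  have D1 : 0 < ((2 * h%:R + 1) * y + (2 * 0 + 2) * e + `|x|) +
    ((2 * h%:R + 1) * y + (2 * 0 + 2) * e + `|x|).
    have := normr_ge0 x; lra.
  by have := @upper_fractionD_le1 R _ _ (s :: a) D1; lra.
have step (x' : R) : `|x'| <= y + e ->
   uf ((2 * h%:R + 1) * y + (2 * H.+1%:R + 2) * e - x') a +
   uf ((2 * h%:R + 1) * y + (2 * H.+1%:R + 2) * e + x') a <=
  (if far x' then (in_value 1 h H x' a + in_value 1 h.+1 H x' a) / 2 else
    out_value 1 h.+1 H.+1 x' a).
  move=> x'ub; rewrite /far; case: ltP => [x'y|x'y]; last exact: (IHa _ _ _).1.
  have ex' : e <= `|x'| by lra.
  set D := _ + _ * e.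
  rewrite upper_fraction_norm.
  have H1 : 2 * uf (D + `|x'|) a <= in_value 1 h.+1 H x' a.
    apply: le_trans ((IHa h H x').2 ex').
    rewrite ler_pM2l //; apply: upper_fraction_le; rewrite /D -natr1; lra.
  suff H2 : 2 * uf (D - `|x'|) a <= in_value 1 h H x' a by lra.
  case: h @D H1 => [|h] D H1.
    have : 1 <= in_value 1 0 H x' a.
      rewrite -[leLHS](sign_average_cst 1 a); apply: le_sign_average => l.
      by rewrite /truncated_tail binomial_tail0 mul1r lerDl.
    have D0 : 0 < (D - `|x'|) + (D - `|x'|).
      by have := D_gt0 0 H.+1 0 e0; have := ler0n R H; rewrite /D -natr1; nra.
    by have := @upper_fractionD_le1 R _ _ a D0; lra.
  apply: le_trans ((IHa h H x').2 ex').
  rewrite ler_pM2l //; apply: upper_fraction_le; rewrite /D -!natr1; lra.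
split=> xb.
  rewrite !upper_fraction_cons.
  set D := _ + _ * e in step *.
  have S1 : uf (D - (x + s)) a + uf (D + (x + s)) a <=
    sign_average ((fun l => truncated_tail 1 h.+1 H.+1
     (uphalf (alternations far near (scanl +%R x l)))) \o cons s) a.
    apply: le_trans (step _ _) _.
      by rewrite (le_trans (ler_normD _ _)) // lerD.
    by case: ifP => E; [rewrite out_value_hit|rewrite out_value_miss ?E].
  have S2 : uf (D - (x - s)) a + uf (D + (x - s)) a <=
    sign_average ((fun l => truncated_tail 1 h.+1 H.+1
     (uphalf (alternations far near (scanl +%R x l)))) \o cons (- s)) a.
    apply: le_trans (step _ _) _.
      by rewrite (le_trans (ler_normD _ _)) // normrN lerD.
    by case: ifP => E; [rewrite out_value_hit|rewrite out_value_miss ?E].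
  rewrite /out_value /=; move: S1 S2.
  rewrite (_ : D - x - s = D - (x + s)); last ring.
  rewrite (_ : D - x + s = D - (x - s)); last ring.
  rewrite (_ : D + x - s = D + (x - s)); last ring.
  rewrite (_ : D + x + s = D + (x + s)); last ring.
  lra.
pose D := (2 * h%:R + 1) * y + (2 * H.+1%:R + 2) * e.
have instep (x' : R) (b : R) : b <= e -> - e <= b -> `|x'| = `|x| + b ->
  2 * uf (D + `|x| + b) a <=
  (if near x' then out_value 1 h.+1 H.+1 x' a else in_value 1 h.+1 H.+1 x' a).
  move=> b1 b2 bx; rewrite /near; case: ltP => [nx|nx]; last first.
    by rewrite -addrA -bx; exact: (IHa _ _ _).2.
  apply: le_trans ((IHa _ _ _).1 _); last lra.
  rewrite -(addrA D) -bx; set u := uf (D + `|x'|) a.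
  rewrite (_ : 2 * u = u + u); last ring.
  rewrite /u; apply: lerD; apply: upper_fraction_le; rewrite /D;
    have := ler_norm x'; have := ler_norm (- x'); rewrite normrN; lra.
have norms (b : R) := norm_addr_small xb (b := b).
have sle' := sle; move: sle'; rewrite ler_norml => /andP[s1 s2].
have S1 : 2 * uf (D + `|x| + (if 0 <= x then s else - s)) a <=
  sign_average ((fun l => truncated_tail 1 h.+1 H.+1
   (half (alternations near far (scanl +%R x l)))) \o cons s) a.
  apply: le_trans (instep (x + s) _ _ _ (norms s sle)) _; try by case: ifP => _; lra.
  by case: ifP => E; [rewrite in_value_hit|rewrite in_value_miss ?E].
have sleN : `|- s| <= e by rewrite normrN.
have S2 : 2 * uf (D + `|x| + (if 0 <= x then - s else - - s)) a <=
  sign_average ((fun l => truncated_tail 1 h.+1 H.+1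
   (half (alternations near far (scanl +%R x l)))) \o cons (- s)) a.
  apply: le_trans (instep (x - s) _ _ _ (norms (- s) sleN)) _; try by case: ifP => _; lra.
  by case: ifP => E; [rewrite in_value_hit|rewrite in_value_miss ?E].
rewrite upper_fraction_cons -/D /in_value /=.
move: S1 S2; case: ifP => _; rewrite ?opprK; lra.
Qed.
End Unfolding.

(** * The normal distribution *)

Section Gaussian.
Context {R : realType}.
Implicit Types (a b c x s : R).
Local Notation mu := (@lebesgue_measure R).

Lemma normal_pdf_even s x : s != 0 -> normal_pdf 0 s (- x) = normal_pdf 0 s x.
Proof. by move=> s0; rewrite !normal_pdfE // /normal_fun !subr0 sqrrN. Qed.

Lemma normal_prob_opp_ray s a : s != 0 ->
  normal_prob 0 s `[- a, +oo[ = normal_prob 0 s `]-oo, a].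
Proof.
move=> s0; rewrite /normal_prob.
rewrite -[in RHS](opprK a) ge0_integration_by_substitutionNy.
- by apply: eq_integral => x _; rewrite /= normal_pdf_even.
- by apply: continuous_subspaceT; exact: continuous_normal_pdf.
- by move=> x _; exact: normal_pdf_ge0.
Qed.

Lemma normal_prob_opp s (C : set R) : s != 0 -> measurable C ->
  normal_prob 0 s (-%R @^-1` C) = normal_prob 0 s C.
Proof.
move=> s0 mC.
have mopp : measurable_fun setT (-%R : measurableTypeR R -> measurableTypeR R).
  exact: oppr_measurable.
pose opp_rv : {mfun (measurableTypeR R) >-> (measurableTypeR R)} :=
  HB.pack (-%R : measurableTypeR R -> measurableTypeR R)
    (isMeasurableFun.Build _ _ _ _ (-%R : measurableTypeR R -> measurableTypeR R) mopp).
pose law : probability (measurableTypeR R) R := normal_prob 0 s.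
pose ray (a : R) : set (measurableTypeR R) := `[a, +oo[%classic.
rewrite -[LHS]/(distribution law opp_rv C) -[RHS]/(law C).
apply: (measure_unique [set I | exists a, I = ray a] (fun n => ray (- n%:R))) => //.
- exact: RGenCInfty.measurableE.
- move=> _ _ [a ->] [b ->]; exists (Num.max a b).
  apply/seteqP; split=> x; rewrite /ray /= !in_itv /= !andbT ge_max.
    by case=> -> ->.
  by move=> /andP[].
- by move=> i; exists (- i%:R).
- rewrite -subTset => x _; exists (Num.truncn `|x|).+1 => //=.
  rewrite /ray /= in_itv /= andbT lerNl; apply: le_trans (ltW (truncnS_gt _)).
  by rewrite -normrN ler_norm.
- move=> _ [a ->]; rewrite /law /distribution /pushforward /ray /= -{2}(opprK a) normal_prob_opp_ray //.
  congr normal_prob; apply/seteqP; split=> x /=; by rewrite !in_itv /= andbT lerNr.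
- by move=> k; apply: (@le_lt_trans _ _ 1%E); [apply: probability_le1; exact: measurable_itv|exact: ltry].
Qed.

Lemma normal_prob_set1 s x : normal_prob 0 s [set x] = 0%E.
Proof.
have /null_content_dominatesP := normal_prob_dominates 0 s.
by apply => //; exact: lebesgue_measure_set1.
Qed.

Lemma normal_prob_scale s x : 0 < s ->
  normal_prob 0 s `]-oo, x] = normal_prob 0 1 `]-oo, x / s].
Proof.
move=> s0; have sN0 := lt0r_neq0 s0.
pose F (u : R) := s * u.
have dF u : derivable F u 1 by exact: derivableM.
have cF : continuous F by move=> u; exact/differentiable_continuous/derivable1_diffP.
have DF : (F^`())%classic = cst s.
  apply/funext => u; rewrite /F derive1E deriveM// derive_cst derive_id.
  by rewrite scaler0 addr0 /GRing.scale /= mulr1.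
have Fx : x = F (x / s) by rewrite /F mulrC divfK.
rewrite /normal_prob {1}Fx increasing_ge0_integration_by_substitutionNy.
- apply: eq_integral => u _; rewrite DF /= !fctE !normal_pdfE ?oner_neq0 //.
  congr (_%:E); rewrite /normal_fun !subr0 /F /normal_peak expr1n mul1r.
  have pi2 : 0 <= pi *+ 2 :> R by rewrite mulrn_wge0 // pi_ge0.
  rewrite -mulrnAr sqrtrM ?sqr_ge0 // sqrtr_sqr gtr0_norm //.
  rewrite (_ : - (s * u) ^+ 2 / (s ^+ 2 *+ 2) = - u ^+ 2 / 2); last by field.
  rewrite invfM; set p := (Num.sqrt _)^-1; set E := expR _.
  by rewrite mulrC !mulrA divff // mul1r.
- by move=> u v _ _ uv; rewrite /F ltr_pM2l.
- by rewrite DF => ? _; exact: cst_continuous.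
- by rewrite DF; exact: is_cvg_cst.
- by rewrite DF; exact: cvg_cst.
- split=> [u _|]; first exact: dF.
  exact/cvg_at_left_filter/cF.
- by apply/gt0_cvgMrNy => //; exact: cvg_id.
- by apply: continuous_subspaceT; exact: continuous_normal_pdf.
- by move=> u _; exact: normal_pdf_ge0.
Qed.

Lemma normal_prob_fin s (C : set R) : measurable C ->
  normal_prob 0 s C = (fine (normal_prob 0 s C))%:E.
Proof. by move=> mC; rewrite fineK // fin_num_measure. Qed.

Lemma normal_prob_upper s c : 0 < s ->
  normal_prob 0 s `[c, +oo[ = (1 - std_normal_cdf (c / s))%:E.
Proof.
move=> s0; have s1 : s != 0 by rewrite gt_eqF.
pose law : probability (measurableTypeR R) R := normal_prob 0 1.
have mray (b : R) : measurable (`]-oo, b]%classic : set R) by exact: measurable_itv.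
rewrite -(opprK c) normal_prob_opp_ray // normal_prob_scale // mulNr opprK.
rewrite -normal_prob_opp_ray ?oner_neq0 // opprK.
rewrite EFinB /std_normal_cdf -normal_prob_fin //.
rewrite -[normal_prob 0 1 _]/(law _) -[X in (_ - X)%E]/(law _).
rewrite -probability_setC // setCitvl -(@setU1itv _ _ _ _ false) ?bnd_simp // measureU //.
- by rewrite [X in (X + _)%E]normal_prob_set1 add0e.
- by apply/seteqP; split => // z [-> /=]; rewrite in_itv /= ltxx.
Qed.

Lemma std_normal_cdf_lipschitz a b :
  `|std_normal_cdf a - std_normal_cdf b| <= normal_peak 1 * `|a - b|.
Proof.
wlog ab : a b / a <= b.
  by move=> W; case/orP: (le_total a b) => /W //; rewrite distrC (distrC b).
pose law : probability (measurableTypeR R) R := normal_prob 0 1.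
have mray (c : R) : measurable (`]-oo, c]%classic : set R) by exact: measurable_itv.
have -> : `|std_normal_cdf a - std_normal_cdf b| = fine (law `]a, b]%classic).
  have E : (law `]-oo, b]%classic = law `]-oo, a]%classic + law `]a, b]%classic)%E.
    rewrite -measureU //.
    - by rewrite -itv_bndbnd_setU ?bnd_simp.
    - by apply/seteqP; split => // z []; rewrite /= !in_itv /= => za /andP[]; rewrite ltNge za.
  have cdfE c : std_normal_cdf c = fine (law `]-oo, c]%classic) by [].
  have {}E : fine (law `]-oo, b]%classic) =
      fine (law `]-oo, a]%classic) + fine (law `]a, b]%classic).
    by rewrite E fineD // fin_num_measure.
  rewrite !cdfE E.
  by rewrite opprD addrA subrr add0r normrN ger0_norm // fine_ge0.
rewrite -lee_fin fineK ?fin_num_measure // ler0_norm ?subr_le0 // opprB.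
rewrite /law /= /normal_prob.
apply: (@le_trans _ _ (\int[mu]_(x in `]a, b]) (normal_peak 1)%:E)%E).
  apply: ge0_le_integral => //=.
  - by move=> x _; rewrite lee_fin normal_pdf_ge0.
  - by apply/measurable_EFinP/measurable_funTS; exact: measurable_normal_pdf.
  - by move=> x _; rewrite lee_fin normal_pdf_ub // oner_neq0.
rewrite integral_cst //= lebesgue_measure_itv /=.
case: ifP => _; first by rewrite EFinM.
by rewrite mule0 lee_fin mulr_ge0 ?normal_peak_ge0 ?subr_ge0.
Qed.
End Gaussian.

(** * Probabilities of events and their limits *)

Section Events.
Context d (T : measurableType d) (R : realType) (P : probability T R).

Definition prob (A : set T) : R := fine (P A).

Lemma probE (A : set T) : measurable A -> P A = (prob A)%:E.
Proof. by move=> mA; rewrite /prob fineK // fin_num_measure. Qed.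

Lemma integral_bool (b : T -> bool) : measurable [set w | b w] ->
  (\int[P]_w ((b w)%:R)%:E)%E = (prob [set w | b w])%:E.
Proof.
move=> mb; rewrite -probE // -[in RHS](setIT [set w | b w]) -integral_indic //.
apply: eq_integral => w _; rewrite indicE; congr ((nat_of_bool _)%:R%:E).
by apply/idP/idP; rewrite inE.
Qed.

Lemma measurable_bool (b : T -> bool) :
  measurable [set w | b w] -> measurable_fun setT (fun w => (b w)%:R : R).
Proof.
move=> mb; rewrite (_ : (fun _ => _) = \1_[set w | b w]).
  exact: measurable_indic.
by apply/funext => w; rewrite indicE; congr ((nat_of_bool _)%:R); apply/idP/idP; rewrite inE.
Qed.

(** For every outcome, F n and E agree from some rank on, which depends on the
    outcome. *)
Definition eventually_equal (F : nat -> set T) (E : set T) :=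
  forall w, exists N, forall n, (N <= n)%N -> (F n w <-> E w).

Lemma measurable_eventually (F : nat -> set T) E :
  (forall n, measurable (F n)) -> eventually_equal F E -> measurable E.
Proof.
move=> mF FE; rewrite (_ : E = \bigcup_N \bigcap_(n in [set n | (N <= n)%N]) F n).
  apply: bigcupT_measurable => N; apply: bigcap_measurable => //.
  by exists N => /=.
apply/seteqP; split => w.
  by move=> Ew; have [N HN] := FE w; exists N => // n /= Nn; apply/HN.
move=> [N _ HN]; have [N' HN'] := FE w.
by apply/(HN' (maxn N N')); [exact: leq_maxr|apply: HN; rewrite /= leq_maxl].
Qed.

Lemma cvg_prob (F : nat -> set T) E :
  (forall n, measurable (F n)) -> eventually_equal F E ->
  prob (F n) @[n --> \oo] --> prob E.
Proof.
move=> mF FE; have mE := measurable_eventually mF FE.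
apply: fine_cvg; rewrite fineK ?fin_num_measure //.
have -> : P E = (\int[P]_w (\1_E w)%:E)%E by rewrite integral_indic // setIT.
rewrite (_ : (fun n => P (F n)) = (fun n => \int[P]_w (\1_(F n) w)%:E)%E); last first.
  by apply/funext => n; rewrite integral_indic // setIT.
apply: (@dominated_cvg _ _ _ _ _ _ _ _ (cst 1%E)) => //.
- by move=> n; apply/measurable_EFinP; exact: measurable_indic.
- move=> w _; apply: cvg_near_cst; have [N HN] := FE w; exists N => // n /= Nn.
  by rewrite !indicE; congr ((nat_of_bool _)%:R%:E); apply/idP/idP;
    rewrite !inE => ?; apply/(HN n Nn).
- by apply: finite_measure_integrable_cst.
- by move=> n w _ /=; rewrite lee_fin indicE ger0_norm // lern1 leq_b1.
Qed.

Lemma prob_ge0 (E : set T) : 0 <= prob E.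
Proof. exact: fine_ge0. Qed.

Lemma prob_le1 (E : set T) : measurable E -> prob E <= 1.
Proof. by move=> mE; rewrite -lee_fin -probE // probability_le1. Qed.

Lemma le_prob (E F : set T) : measurable E -> measurable F -> E `<=` F -> prob E <= prob F.
Proof. by move=> mE mF EF; rewrite -lee_fin -!probE // le_measure ?inE. Qed.

End Events.

(** * Sign invariance of independent symmetric variables *)

Section SignVectors.
Context {R : realFieldType}.
Implicit Types (F : seq R -> R) (a : seq R) (b : seq bool) (n : nat).

Fixpoint sign_vectors n : seq (seq bool) :=
  if n is n'.+1 then
    map (cons false) (sign_vectors n') ++ map (cons true) (sign_vectors n')
  else [:: [::]].

Fixpoint apply_signs b a : seq R :=
  match b, a with
  | c :: b', s :: a' => (if c then - s else s) :: apply_signs b' a'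
  | _, _ => a
  end.

Lemma size_apply_signs b a : size (apply_signs b a) = size a.
Proof. by elim: a b => [|s a IH] [|c b] //=; rewrite IH. Qed.

Lemma nth_apply_signs b a i :
  nth 0 (apply_signs b a) i = if nth false b i then - nth 0 a i else nth 0 a i.
Proof.
elim: a b i => [|s a IH] [|c b] [|i] //=; rewrite ?nth_nil ?oppr0 ?if_same //.
Qed.

Lemma size_sign_vectors n : size (sign_vectors n) = (2 ^ n)%N.
Proof. by elim: n => //= n IH; rewrite size_cat !size_map IH expnS mul2n addnn. Qed.

Lemma sign_averageE F a : sign_average F a =
  \sum_(b <- sign_vectors (size a)) (2^-1) ^+ size a * F (apply_signs b a).
Proof.
elim: a F => [|s a IH] F /=; first by rewrite big_seq1 expr0 mul1r.
rewrite !IH big_cat !big_map /= mulrDl !mulr_suml.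
by congr (_ + _); apply: eq_bigr => b _ /=; rewrite exprS; ring.
Qed.

End SignVectors.

Section LawInvariance.
Context d (T : measurableType d) (R : realType) (P : probability T R).

(** The boxes form a pi-system that generates the product sigma-algebra. *)
Lemma tuple_law_unique n (Y Z : {mfun T >-> n.-tuple R}) :
  (forall C : 'I_n -> set R, (forall i, measurable (C i)) ->
    P [set w | forall i, C i (tnth (Y w) i)] =
    P [set w | forall i, C i (tnth (Z w) i)]) ->
  forall E, measurable E -> distribution P Y E = distribution P Z E.
Proof.
move=> YZ E mE.
pose G := [set E : set (n.-tuple R) | exists2 C : 'I_n -> set R,
  (forall i, measurable (C i)) & E = [set u | forall i, C i (tnth u i)]].
apply: (measure_unique G (fun=> setT)) => //.
- apply/seteqP; split.
    apply: smallest_sub; first exact: smallest_sigma_algebra.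
    move=> A; rewrite -bigcup_seq => -[i /= _] [D mD <-].
    apply: sub_sigma_algebra; exists (fun j => if j == i then D else setT).
      by move=> j; case: ifP.
    rewrite setTI; apply/seteqP; split => u /= uD.
      by move=> j; case: ifP => // /eqP ->.
    by move: (uD i); rewrite eqxx.
  apply: smallest_sub; first exact: sigma_algebra_measurable.
  move=> A [C mC ->].
  rewrite [X in measurable X](_ : _ = \bigcap_(i in [set: 'I_n]) (@tnth n R ^~ i) @^-1` C i); last first.
    by apply/seteqP; split => u /= uC i; [move=> _|]; apply: uC.
  apply: fin_bigcap_measurable => // i _; rewrite -[X in measurable X]setTI.
  exact: measurable_tnth.
- move=> _ _ [C mC ->] [D mD ->]; exists (fun i => C i `&` D i).
    by move=> i; exact: measurableI.
  apply/seteqP; split => u /=; first by move=> [uC uD] i; split.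
  by move=> uCD; split=> i; case: (uCD i).
- by move=> _; exists (fun=> setT) => //; apply/seteqP; split.
- by rewrite bigcup_const.
- by move=> _ [C mC ->]; exact: YZ.
- by move=> k; apply: (@le_lt_trans _ _ 1%E); [exact: probability_le1|exact: ltry].
Qed.

Variable X : nat -> T -> R.
Hypothesis mX : forall i, measurable_fun setT (X i).
Hypothesis indepX : mutually_independent P X.
Hypothesis symX : forall i (C : set R), measurable C ->
  P [set w | C (- X i w)] = P (X i @^-1` C).

Definition signed_steps n (b : seq bool) w : n.-tuple R :=
  [tuple (if nth false b i then - X i w else X i w) | i < n].

Lemma measurable_signed_steps n b : measurable_fun setT (signed_steps n b).
Proof.
apply/measurable_fun_tnthP => i.
rewrite [X in measurable_fun _ X](_ : _ = fun w => if nth false b i then - X i w else X i w).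
  case: (nth false b i); last exact: mX.
  exact: (measurableT_comp (@oppr_measurable R setT) (mX i)).
by apply/funext => w /=; rewrite tnth_mktuple.
Qed.
HB.instance Definition _ n b :=
  isMeasurableFun.Build _ _ _ _ (signed_steps n b) (@measurable_signed_steps n b).

Lemma val_signed_steps n b w :
  val (signed_steps n b w) = apply_signs b (mkseq (X ^~ w) n).
Proof.
apply: (@eq_from_nth _ 0); first by rewrite size_tuple size_apply_signs size_mkseq.
move=> i; rewrite size_tuple => ltin.
rewrite nth_apply_signs nth_mkseq // -[i]/(val (Ordinal ltin)) -tnth_nth.
by rewrite tnth_mktuple.
Qed.

Lemma signed_steps_law n b E : measurable E ->
  distribution P (signed_steps n b) E = distribution P (signed_steps n [::]) E.
Proof.
apply: tuple_law_unique => C mC.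
pose C' (b : seq bool) (i : nat) : set R := if insub i is Some j then
  (if nth false b i then (-%R) @^-1` C j else C j) else setT.
have mC' c i : measurable (C' c i).
  rewrite /C'; case: insubP => [j _ _|_] //; case: ifP => _ //.
  by rewrite -[X in measurable X]setTI; exact: oppr_measurable.
have E1 c : [set w | forall i, C i (tnth (signed_steps n c w) i)] =
  \bigcap_(i in [set` iota 0 n]) X i @^-1` C' c i.
  apply/seteqP; split => w /= wC i.
    rewrite /= mem_iota /= => ltin; rewrite /C' insubT /=.
    have := wC (Ordinal ltin); rewrite tnth_mktuple /=; by case: ifP.
  have := wC i; rewrite /= mem_iota /= ltn_ord => /(_ isT).
  by rewrite /C' valK tnth_mktuple; case: ifP.
rewrite !E1 !indepX ?iota_uniq //; apply: eq_bigr => i _.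
rewrite /C'; case: insubP => [j _ ij|_] //=.
rewrite nth_nil; case: ifP => _ //; exact: symX.
Qed.

(** Changing the signs of some of the variables does not change the joint law,
    and the sign average is the mean over all such changes. *)
Lemma integral_sign_average n (F : seq R -> R) :
  measurable_fun setT (fun u : n.-tuple R => F u) -> (forall l, 0 <= F l) ->
  (\int[P]_w (sign_average F (mkseq (X ^~ w) n))%:E =
   \int[P]_w (F (mkseq (X ^~ w) n))%:E)%E.
Proof.
move=> mF F0.
have mFb b : measurable_fun setT (fun w => F (apply_signs b (mkseq (X ^~ w) n))).
  have -> : (fun w => F (apply_signs b (mkseq (X ^~ w) n))) =
      (fun u : n.-tuple R => F u) \o signed_steps n b.
    by apply/funext => w; congr F; rewrite -val_signed_steps.
  exact: (measurableT_comp mF (measurable_signed_steps b)).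
have Eb b : (\int[P]_w (F (apply_signs b (mkseq (X ^~ w) n)))%:E =
             \int[P]_w (F (mkseq (X ^~ w) n))%:E)%E.
  have mF' : measurable_fun setT (fun u : n.-tuple R => (F u)%:E).
    exact/measurable_EFinP.
  have I c : (\int[P]_w (F (apply_signs c (mkseq (X ^~ w) n)))%:E =
     \int[distribution P (signed_steps n c)]_u (F u)%:E)%E.
    rewrite ge0_integral_distribution //; last by move=> u; rewrite lee_fin.
    by apply: eq_integral => w _; congr (F _)%:E; rewrite -val_signed_steps.
  rewrite I (eq_measure_integral (distribution P (signed_steps n [::]))); last first.
    by move=> A mA _; exact: signed_steps_law.
  by rewrite -I; apply: eq_integral => w _; case: (mkseq _ _).
under eq_integral do rewrite sign_averageE size_mkseq -sumEFin.
rewrite ge0_integral_sum //; last 2 first.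
- move=> b; apply/measurable_EFinP; exact: measurable_funM.
- by move=> b w _; rewrite lee_fin mulr_ge0 // exprn_ge0 // invr_ge0.
have Ebc b : (\int[P]_w (2^-1 ^+ n * F (apply_signs b (mkseq (X ^~ w) n)))%:E =
    (2^-1 ^+ n)%:E * \int[P]_w (F (mkseq (X ^~ w) n))%:E)%E.
  rewrite -(Eb b) -ge0_integralZl_EFin //.
  - by move=> w _; rewrite lee_fin.
  - exact/measurable_EFinP.
rewrite (eq_bigr _ (fun b _ => Ebc b)).
rewrite -ge0_sume_distrl; last by move=> b _; rewrite lee_fin exprn_ge0 // invr_ge0.
rewrite sumEFin big_const_seq count_predT size_sign_vectors iter_addr_0.
by rewrite -(mulr_natl (2^-1 ^+ n)) natrX -exprMn mulfV ?pnatr_eq0 // expr1n mul1e.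
Qed.
End LawInvariance.

(** * The discrete estimate *)

Section Measurability.
Context d (T : measurableType d) (R : realType).

Lemma measurable_alternations (I : Type) (X : I -> T -> R) (s : seq I)
    (p q : pred R) (x : T -> R) k :
  (forall i, measurable_fun setT (X i)) -> measurable_fun setT x ->
  measurable [set z | p z] -> measurable [set z | q z] ->
  measurable [set w | (k <= alternations p q (scanl +%R (x w) (map (X ^~ w) s)))%N].
Proof.
move=> mX; elim: s p q x k => [|i s IH] p q x k mx mp mq.
  case: k => [|k] /=; first by rewrite (_ : [set _ | _] = setT) //; apply/seteqP; split.
  by rewrite (_ : [set _ | _] = set0) //; apply/seteqP; split.
pose x' w := x w + X i w.
have mx' : measurable_fun setT x' by exact: measurable_funD.
have mpx' : measurable (x' @^-1` [set z | p z]).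
  by rewrite -[X in measurable X]setTI; exact: mx'.
rewrite (_ : [set _ | _] =
  (x' @^-1` [set z | p z] `&`
     [set w | (k.-1 <= alternations q p (scanl +%R (x' w) (map (X ^~ w) s)))%N]) `|`
  (~` (x' @^-1` [set z | p z]) `&`
     [set w | (k <= alternations p q (scanl +%R (x' w) (map (X ^~ w) s)))%N])).
  by apply: measurableU; apply: measurableI;
    [|exact: IH|exact: measurableC|exact: IH].
apply/seteqP; split=> w /=; rewrite -/(x' w).
  by case: ifPn => px; [left; split => //; move: H; lia|right; split => //; exact/negP].
case=> [[-> ]|[/negP/negbTE -> //]]; lia.
Qed.

End Measurability.

Section DiscreteEstimate.
Context d (T : measurableType d) (R : realType) (P : probability T R).
Local Notation prob := (prob P).
Variable X : nat -> T -> R.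
Hypothesis mX : forall i, measurable_fun setT (X i).
Hypothesis indepX : mutually_independent P X.
Hypothesis symX : forall i (C : set R), measurable C ->
  P [set w | C (- X i w)] = P (X i @^-1` C).
Variables (n : nat) (y e : R).

(** An alternating subsequence of length 2k-1 or 2k visits k times the region
    beyond y. *)
Definition excursion_count (l : seq R) : nat :=
  uphalf (alternations (far y) (near e) (scanl +%R 0 l)).

Let steps w := mkseq (X ^~ w) n.
Let small (l : seq R) := all (fun s => `|s| <= e) l.

Lemma measurable_far (z : R) : measurable [set x | far z x].
Proof.
rewrite (_ : [set x | _] = (@Num.norm _ R) @^-1` `]z, +oo[%classic).
  by rewrite -[X in measurable X]setTI; exact: normr_measurable.
by apply/seteqP; split => x; rewrite /= in_itv /= andbT.
Qed.

Lemma measurable_near (z : R) : measurable [set x | near z x].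
Proof.
rewrite (_ : [set x | _] = (@Num.norm _ R) @^-1` `]-oo, z[%classic).
  by rewrite -[X in measurable X]setTI; exact: normr_measurable.
by apply/seteqP; split => x; rewrite /= in_itv.
Qed.

Lemma uphalf_geq k m : (k <= uphalf m)%N = (k.*2.-1 <= m)%N.
Proof. by rewrite uphalfE; case: k => // k; lia. Qed.

Lemma measurable_excursion_count d' (T' : measurableType d') (I : Type)
    (Y : I -> T' -> R) (s : seq I) k : (forall i, measurable_fun setT (Y i)) ->
  measurable [set w | (k <= excursion_count (map (Y ^~ w) s))%N].
Proof.
move=> mY; rewrite /excursion_count.
under eq_set do rewrite uphalf_geq.
by apply: measurable_alternations => //; [exact: measurable_far|exact: measurable_near].
Qed.

Lemma measurable_excursion_count_tuple k :
  measurable [set u : n.-tuple R | (k <= excursion_count u)%N].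
Proof.
rewrite (_ : [set _ | _] = [set u : n.-tuple R |
   (k <= excursion_count (map (fun i => tnth u i) (enum 'I_n)))%N]); last first.
  by apply/seteqP; split => u /=; rewrite map_tnth_enum.
apply: (@measurable_excursion_count _ _ _ (fun i (u : n.-tuple R) => tnth u i)) => i.
exact: measurable_tnth.
Qed.

Lemma measurable_sum_tuple c :
  measurable [set u : n.-tuple R | c <= \sum_(s <- u) s].
Proof.
rewrite (_ : [set _ | _] =
   (fun u : n.-tuple R => \sum_(i < n) tnth u i) @^-1` `[c, +oo[%classic).
  rewrite -[X in measurable X]setTI.
  apply: (@measurable_sum _ _ _ setT) => // i; exact: measurable_tnth.
by apply/seteqP; split => u; rewrite /= in_itv /= andbT big_tuple.
Qed.

Lemma measurable_count_event k :
  measurable [set w | (k <= excursion_count (steps w))%N].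
Proof. exact: measurable_excursion_count. Qed.

Lemma measurable_endpoint_event c : measurable [set w | c <= \sum_(i < n) X i w].
Proof.
rewrite (_ : [set _ | _] = (fun w => \sum_(i < n) X i w) @^-1` `[c, +oo[%classic).
  by rewrite -[X in measurable X]setTI; exact: (@measurable_sum _ _ _ setT).
by apply/seteqP; split => w; rewrite /= in_itv /= andbT.
Qed.

Lemma measurable_large_step : measurable [set w | ~~ small (steps w)].
Proof.
rewrite (_ : [set w | _] =
    \bigcup_(i in [set` iota 0 n]) (X i @^-1` [set x | far e x])).
  apply: fin_bigcup_measurable => // i _.
  by rewrite -[X in measurable X]setTI; apply: mX => //; exact: measurable_far.
apply/seteqP; split => w /=.
  rewrite -has_predC has_map => /hasP[i ni /=]; rewrite -ltNge => ei.
  by exists i.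
case=> i /= ni ei; rewrite -has_predC has_map; apply/hasP; exists i => //=.
by rewrite -ltNge.
Qed.

Lemma truncated_tailE (theta : R) h H N : truncated_tail theta h.+1 H N =
  \sum_(1 <= k < H.+1) binomial_tail_step 2^-1 h.+1 k * (k <= N)%:R +
  theta * (H <= N)%:R.
Proof. by rewrite /truncated_tail binomial_tail_minn. Qed.

Lemma half_step_ge0 h k : 0 <= binomial_tail_step (2^-1 : R) h k.
Proof. by apply: binomial_tail_step_ge0; lra. Qed.

Lemma truncated_tail_ge0 (theta : R) h H N : 0 <= theta -> 0 <= truncated_tail theta h.+1 H N.
Proof.
move=> t0; rewrite truncated_tailE addr_ge0 ?mulr_ge0 //.
by apply: sumr_ge0 => k _; rewrite mulr_ge0 // half_step_ge0.
Qed.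

Lemma measurable_truncated_tail (theta : R) h H :
  measurable_fun setT (fun u : n.-tuple R => truncated_tail theta h.+1 H (excursion_count u)).
Proof.
under eq_fun do rewrite truncated_tailE.
apply: measurable_funD.
  apply: measurable_sum => k; apply: measurable_funM => //.
  by apply: measurable_bool; exact: measurable_excursion_count_tuple.
apply: measurable_funM => //.
by apply: measurable_bool; exact: measurable_excursion_count_tuple.
Qed.

Lemma integral_truncated_tail (theta : R) h H : 0 <= theta ->
  (\int[P]_w (truncated_tail theta h.+1 H (excursion_count (steps w)))%:E)%E =
  (\sum_(1 <= k < H.+1) binomial_tail_step 2^-1 h.+1 k *
      prob [set w | (k <= excursion_count (steps w))%N] +
   theta * prob [set w | (H <= excursion_count (steps w))%N])%:E.
Proof.
move=> t0.
have mb k : measurable_fun setT (fun w => ((k <= excursion_count (steps w))%N%:R : R)).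
  by apply: measurable_bool; exact: measurable_count_event.
have mcb (c : R) k : measurable_fun setT (fun w => (c * (k <= excursion_count (steps w))%N%:R)%:E).
  by apply/measurable_EFinP; exact: measurable_funM.
have Icb (c : R) k : 0 <= c ->
   (\int[P]_w ((c * (k <= excursion_count (steps w))%N%:R)%:E))%E =
   (c * prob [set w | (k <= excursion_count (steps w))%N])%:E.
  move=> c0; under eq_integral do rewrite EFinM.
  rewrite ge0_integralZl_EFin //.
  - by rewrite integral_bool //; exact: measurable_count_event.
  - by apply/measurable_EFinP.
under eq_integral do rewrite truncated_tailE EFinD -sumEFin.
rewrite ge0_integralD //.
- rewrite Icb // ge0_integral_sum //.
  + rewrite EFinD -sumEFin; congr (_ + _)%E; apply: eq_bigr => k _.
    by rewrite Icb // half_step_ge0.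
  + by move=> k w _; rewrite lee_fin mulr_ge0 // half_step_ge0.
- move=> w _; apply: sume_ge0 => k _; rewrite lee_fin mulr_ge0 // half_step_ge0 //.
- by apply: emeasurable_sum.
- by move=> w _; rewrite lee_fin mulr_ge0.
Qed.

Lemma sum_steps w : \sum_(s <- steps w) s = \sum_(i < n) X i w.
Proof. by rewrite /steps /mkseq big_map -{1}(subn0 n) big_mkord. Qed.

Lemma measurable_endpoint_tuple c :
  measurable_fun setT (fun u : n.-tuple R => (c <= \sum_(s <- u) s)%R%:R : R).
Proof. by apply: measurable_bool; exact: measurable_sum_tuple. Qed.

Lemma integral_upper_fraction c :
  (\int[P]_w (upper_fraction c (steps w))%:E)%E =
  (prob [set w | c <= \sum_(i < n) X i w])%:E.
Proof.
rewrite integral_sign_average //; last exact: measurable_endpoint_tuple.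
under eq_integral do rewrite sum_steps.
by rewrite integral_bool //; exact: measurable_endpoint_event.
Qed.

Lemma measurable_sign_average (F : seq R -> R) :
  measurable_fun setT (fun u : n.-tuple R => F u) ->
  measurable_fun setT (fun w => sign_average F (steps w)).
Proof.
move=> mF; under eq_fun do rewrite sign_averageE size_mkseq.
apply: measurable_sum => b; apply: measurable_funM => //.
rewrite (_ : (fun w => F (apply_signs b (steps w))) =
    (fun u : n.-tuple R => F u) \o signed_steps X n b).
  exact: (measurableT_comp mF (@measurable_signed_steps _ _ _ _ mX n b)).
by apply/funext => w; congr F; rewrite -val_signed_steps.
Qed.

Lemma integral_upper_fraction_small r c : 0 <= r ->
  (\int[P]_w (2 * upper_fraction c (steps w) + r * (~~ small (steps w))%:R)%:E)%E =
  (2 * prob [set w | c <= \sum_(i < n) X i w] +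
   r * prob [set w | ~~ small (steps w)])%:E.
Proof.
move=> r0.
have ms : measurable_fun setT (fun w => (~~ small (steps w))%:R : R).
  by apply: measurable_bool; exact: measurable_large_step.
have mu : measurable_fun setT (fun w => upper_fraction c (steps w)).
  by apply: measurable_sign_average; exact: measurable_endpoint_tuple.
have u0 w : 0 <= upper_fraction c (steps w) by exact: upper_fraction_ge0.
under eq_integral do rewrite EFinD 2!EFinM.
rewrite ge0_integralD //.
- rewrite !ge0_integralZl_EFin //.
  + rewrite integral_upper_fraction integral_bool //; exact: measurable_large_step.
  + exact/measurable_EFinP.
  + by move=> w _; rewrite lee_fin.
  + exact/measurable_EFinP.
- by move=> w _; rewrite mule_ge0 // lee_fin.
- by apply/measurable_EFinP; exact: measurable_funM.
- by move=> w _; rewrite mule_ge0 // lee_fin.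
- by apply/measurable_EFinP; exact: measurable_funM.
Qed.

Lemma truncated_tail_le1 h H N : truncated_tail (0 : R) h.+1 H N <= 1.
Proof.
rewrite /truncated_tail mul0r addr0.
by have /andP[] : 0 <= binomial_tail (2^-1 : R) h.+1 (minn H N) <= 1
  by apply: binomial_tail_bound; lra.
Qed.

(** When all steps are at most e, the sign average is bounded by
    [unfolding_upper] with x = 0, where the two displacements agree; otherwise it
    is at most 1. *)
Lemma mean_count_upper h H : 0 < e -> e <= y ->
  \sum_(1 <= k < H.+1) binomial_tail_step 2^-1 h.+1 k *
      prob [set w | (k <= excursion_count (steps w))%N] <=
  2 * prob [set w | (2 * h%:R + 1) * y - 2 * H%:R * e <= \sum_(i < n) X i w] +
  prob [set w | ~~ small (steps w)].
Proof.
move=> e0 ey; rewrite -[X in _ <= _ + X]mul1r -lee_fin.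
rewrite -integral_upper_fraction_small //.
have := @integral_truncated_tail 0 h H (lexx 0); rewrite mul0r addr0 => <-.
pose F (l : seq R) := truncated_tail 0 h.+1 H (excursion_count l) : R.
have mF : measurable_fun setT (fun u : n.-tuple R => F u).
  exact: measurable_truncated_tail.
rewrite -(integral_sign_average mX indepX symX mF); last first.
  by move=> l; exact: truncated_tail_ge0.
have u0 c a : 0 <= upper_fraction (c : R) a by exact: upper_fraction_ge0.
apply: ge0_le_integral => //.
- move=> w _; rewrite lee_fin -(sign_average_cst 0 (steps w)).
  by apply: le_sign_average => l; exact: truncated_tail_ge0.
- by apply/measurable_EFinP; exact: measurable_sign_average.
- apply/measurable_EFinP; apply: measurable_funD; apply: measurable_funM => //.
    by apply: measurable_sign_average; exact: measurable_endpoint_tuple.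
  by apply: measurable_bool; exact: measurable_large_step.
- move=> w _; rewrite lee_fin mul1r.
  case: (boolP (small (steps w))) => sw; last first.
    apply: (@le_trans _ _ 1); last by rewrite lerDr mulr_ge0.
    rewrite -[leRHS](sign_average_cst 1 (steps w)); apply: le_sign_average => l.
    exact: truncated_tail_le1.
  have y0 : 0 <= y by lra.
  have := (unfolding_upper e0 ey sw h H 0).1; rewrite normr0 => /(_ y0).
  rewrite subr0 addr0 => /le_trans; apply.
  by set u := upper_fraction _ _; rewrite (_ : 2 * u = u + u) ?lerDl //; ring.
Qed.

(** The middle term pays for the bonus that [unfolding_lower] grants to walks with
    H excursions or more. *)
Lemma mean_count_lower h H : 0 < e -> e <= y ->
  2 * prob [set w | (2 * h%:R + 1) * y + (2 * H%:R + 2) * e <= \sum_(i < n) X i w] <=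
  \sum_(1 <= k < H.+1) binomial_tail_step 2^-1 h.+1 k *
      prob [set w | (k <= excursion_count (steps w))%N] +
  prob [set w | (H <= excursion_count (steps w))%N] +
  2 * prob [set w | ~~ small (steps w)].
Proof.
move=> e0 ey; set c := _ + _ * e; rewrite -[X in _ <= _ + X + _]mul1r.
rewrite -lee_fin EFinD -integral_truncated_tail //.
have -> : ((2 * prob [set w | c <= \sum_(i < n) X i w])%:E =
   \int[P]_w (2 * upper_fraction c (steps w))%:E)%E.
  have := integral_upper_fraction_small c (lexx 0); rewrite mul0r addr0 => <-.
  by apply: eq_integral => w _; rewrite mul0r addr0.
have -> : ((2 * prob [set w | ~~ small (steps w)])%:E =
   \int[P]_w (2 * (~~ small (steps w))%:R)%:E)%E.
  under eq_integral do rewrite EFinM.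
  rewrite ge0_integralZl_EFin //.
  - by rewrite integral_bool //; exact: measurable_large_step.
  - apply/measurable_EFinP; apply: measurable_bool; exact: measurable_large_step.
pose F (l : seq R) := truncated_tail 1 h.+1 H (excursion_count l) : R.
have mF : measurable_fun setT (fun u : n.-tuple R => F u).
  exact: measurable_truncated_tail.
rewrite -(integral_sign_average mX indepX symX mF); last first.
  by move=> l; exact: truncated_tail_ge0.
have F0 w : 0 <= sign_average F (steps w).
  rewrite -(sign_average_cst 0 (steps w)).
  by apply: le_sign_average => l; exact: truncated_tail_ge0.
have u0 a : 0 <= upper_fraction c a by exact: upper_fraction_ge0.
have u1 a : upper_fraction c a <= 1 by exact: upper_fraction_le1.
have mS : measurable_fun setT (fun w => sign_average F (steps w)).
  exact: measurable_sign_average.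
have ms : measurable_fun setT (fun w => (2 * (~~ small (steps w))%:R : R)).
  apply: measurable_funM => //; apply: measurable_bool; exact: measurable_large_step.
rewrite -ge0_integralD //; [|by move=> w _; rewrite lee_fin; exact: F0|exact/measurable_EFinP
  |exact/measurable_EFinP].
apply: ge0_le_integral => //.
- by move=> w _; rewrite lee_fin mulr_ge0.
- apply/measurable_EFinP; apply: measurable_funM => //.
  by apply: measurable_sign_average; exact: measurable_endpoint_tuple.
- by apply: emeasurable_funD; exact/measurable_EFinP.
- move=> w _; rewrite -EFinD lee_fin.
  case: (boolP (small (steps w))) => sw; last first.
    by have := u1 (steps w); have := F0 w; rewrite (_ : (~~ false)%:R = 1 :> R) //; lra.
  have y0 : 0 <= y by lra.
  have := (unfolding_lower e0 ey sw h H 0).1; rewrite normr0 => /(_ y0).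
  rewrite subr0 addr0 mulr0 addr0 -/c => low.
  apply: le_trans low.
  by set u := upper_fraction _ _; rewrite (_ : 2 * u = u + u) //; ring.
Qed.

End DiscreteEstimate.

(** * Alternating chains of times on a continuous path *)

Fixpoint alternating (X : Type) (p q : pred X) (s : seq X) : bool :=
  if s is x :: s' then p x && alternating q p s' else true.

Section Alternating.
Context {X : eqType}.
Implicit Types (p q : pred X) (us ts : seq X).

Lemma alternating_take p q us r : alternating p q us -> alternating p q (take r us).
Proof.
elim: us p q r => [|u us IH] p q [|r] //= /andP[pu] /IH alt.
by rewrite pu alt.
Qed.

Lemma alternating_all p q us : alternating p q us -> all (fun u => p u || q u) us.
Proof.
elim: us p q => [|u us IH] //= p q /andP[-> /IH alt] /=.
by rewrite (eq_all (a2 := fun v => q v || p v)) // => v /=; rewrite orbC.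
Qed.

Lemma alternating_and p q r us : all r us -> alternating p q us ->
  alternating (fun u => p u && r u) (fun u => q u && r u) us.
Proof.
elim: us p q => [|u us IH] //= p q /andP[ru rus] /andP[pu alt].
by rewrite pu ru /=; exact: IH.
Qed.

Lemma alternations_greedy p q us ts :
  subseq us ts -> alternating p q us -> (size us <= alternations p q ts)%N.
Proof.
elim: ts p q us => [|z ts IH] p q us; first by rewrite subseq0 => /eqP ->.
case: us => [|u us] //= + /andP[pu alt]; case: eqP => [<-|_] sub.
  by rewrite pu ltnS; exact: IH.
case: ifP => pz; last by apply: (IH _ _ (u :: us)) => //=; rewrite pu.
by rewrite ltnS; apply: IH alt; exact: subseq_trans (subseq_cons _ _) sub.
Qed.

Lemma alternations_chain p q ts :
  exists us, [/\ subseq us ts, alternating p q us & size us = alternations p q ts].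
Proof.
elim: ts p q => [|z ts IH] p q; first by exists [::].
rewrite /=; case: ifP => pz.
  have [us [sub alt sz]] := IH q p.
  by exists (z :: us); rewrite /= eqxx pz alt sz.
have [us [sub alt sz]] := IH p q.
by exists us; split => //; exact: subseq_trans sub (subseq_cons _ _).
Qed.

End Alternating.

Lemma alternating_map (X Y : Type) (f : X -> Y) (p q : pred X) (p' q' : pred Y) us :
  (forall u, p u -> p' (f u)) -> (forall u, q u -> q' (f u)) ->
  alternating p q us -> alternating p' q' (map f us).
Proof.
elim: us p q p' q' => [|u us IH] //= p q p' q' pp' qq' /andP[pu alt].
by rewrite pp' //=; exact: (IH q p).
Qed.

Section SortedReals.
Context {R : realType}.
Implicit Types (p q : pred R) (us ts : seq R).

Lemma sorted_alternating (f : R -> R) p q us :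
  (forall u v, u < v -> p u && q v || q u && p v -> f u < f v) ->
  alternating p q us -> sorted <%R us -> sorted <%R (map f us).
Proof.
case: us => [|u us] //= fmono; elim: us u p q fmono => [|v us IH] //= u p q fmono.
move=> /and3P[pu qv alt] /andP[uv pv].
rewrite fmono ?pu ?qv //=; apply: (IH v q p) => //=; last by rewrite qv.
by move=> a b ab H; apply: fmono => //; rewrite orbC.
Qed.

Lemma sorted_lt_subseq us ts : sorted <%R us -> sorted <%R ts ->
  {subset us <= ts} -> subseq us ts.
Proof.
move=> sus sts sub; have -> : us = [seq x <- ts | x \in us].
  apply: (irr_sorted_eq lt_trans ltxx) => //.
    by apply: sorted_filter => //; exact: lt_trans.
  by move=> x; rewrite mem_filter; case: (boolP (x \in us)) => // /sub ->.
exact: filter_subseq.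
Qed.

End SortedReals.

Lemma scanl_telescope {V : zmodType} (f : nat -> V) n :
  scanl +%R (f 0%N) (mkseq (fun i => f i.+1 - f i) n) =
  mkseq (fun i => f i.+1) n.
Proof.
rewrite /mkseq; move: 0%N => m; elim: n m => [|n IH] m //=.
by rewrite addrC subrK IH.
Qed.

Section Path.
Context {R : realType}.
Variables (b : R -> R) (t y : R).
Hypotheses (cb : continuous b) (b0 : b 0 = 0) (t0 : 0 < t) (y0 : 0 < y).

Definition times (us : seq R) := all (fun u => 0 <= u <= t) us.

Definition above (u : R) := y < `|b u|.
Definition below (e u : R) := `|b u| < e.
Definition at_zero (u : R) := b u == 0.

(** A chain of length 2k-1 for q = at_zero visits k distinct excursions beyond y. *)
Definition chain (q : pred R) r := exists us : seq R,
  [/\ size us = r, sorted <%R us, times us & alternating above q us].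

Lemma chain_le q r r' : (r' <= r)%N -> chain q r -> chain q r'.
Proof.
move=> rr [us [sz sus tus alt]]; exists (take r' us); split.
- by rewrite size_take sz; case: ltngtP rr => //; lia.
- exact: take_sorted.
- by apply/allP => u /mem_take; move/allP: tus; apply.
- exact: alternating_take.
Qed.

Lemma chain_sub (q q' : pred R) r : {subset q <= q'} -> chain q r -> chain q' r.
Proof.
move=> qq' [us [sz sus tus alt]]; exists us; split => //.
by rewrite -(map_id us); apply: (@alternating_map _ _ id above q).
Qed.

Lemma local_modulus (u e : R) : 0 < e ->
  exists2 h : R, 0 < h & forall v : R, `|u - v| < h -> `|b u - b v| < e.
Proof.
move=> e0; have /cvgrPdist_lt/(_ _ e0)/nbhs_ballP [h /= h0 H] := @cb u.
by exists h => // v uv; exact: H.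
Qed.

(** The Heine theorem on [0, t], by compactness in near-covering form. *)
Lemma uniform_modulus (e : R) : 0 < e ->
  exists2 h : R, 0 < h & forall u v : R, 0 <= u <= t -> 0 <= v <= t ->
    `|u - v| < h -> `|b u - b v| < e.
Proof.
move=> e0.
have := @segment_compact R 0 t; rewrite compact_near_coveringP => cov.
have [] := cov R (0^'+) (fun h u => forall v : R, 0 <= v <= t -> `|u - v| < h -> `|b u - b v| < e) _.
  move=> u _.
  have e2 : 0 < e / 2 by rewrite divr_gt0.
  have [h h0 H] := local_modulus u e2.
  have h2 : 0 < h / 2 by rewrite divr_gt0.
  near=> u' k => v _ /= uv.
  have uu' : `|u - u'| < h / 2.
    by near: u'; apply/nbhs_ballP; exists (h / 2).
  have kh : k < h / 2 by near: k; exact: nbhs_right_lt.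
  have H1 : `|b u - b u'| < e / 2 by apply: H; lra.
  have H2 : `|b u - b v| < e / 2.
    apply: H; rewrite (_ : u - v = (u - u') + (u' - v)); last ring.
    by apply: le_lt_trans (ler_normD _ _) _; lra.
  rewrite /= (_ : b u' - b v = (b u - b v) - (b u - b u')); last ring.
  by apply: le_lt_trans (ler_normB _ _) _; lra.
move=> h /= h0 H; exists (h / 2); first by rewrite divr_gt0.
move=> u v tu tv uv; apply: (H (h / 2)) => //=.
- by rewrite sub0r normrN ger0_norm; lra.
- by rewrite divr_gt0.
Unshelve. all: by end_near. Qed.

Lemma alternating_spread (h : R) p q (u : R) us :
  (forall v w : R, 0 <= v <= t -> 0 <= w <= t -> p v && q w || q v && p w -> h <= `|v - w|) ->
  alternating p q (u :: us) -> path <%R u us -> times (u :: us) ->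
  u + (size us)%:R * h <= t.
Proof.
elim: us u p q => [|v us IH] u p q sep /=.
  by move=> _ _ /andP[/andP[_ ut] _]; rewrite mul0r addr0.
move=> /and3P[pu qv alt] /andP[uv pv] /and3P[tu tv tus].
have vt : v + (size us)%:R * h <= t.
  apply: (IH v q p) => //=; rewrite ?qv ?tv //.
  by move=> a c ta tc pq; apply: sep => //; rewrite orbC.
have : h <= `|u - v| by apply: sep => //; rewrite pu qv.
by rewrite distrC gtr0_norm ?subr_gt0 // -natr1 mulrDl mul1r; lra.
Qed.

(** By uniform continuity, consecutive times of a chain are at a distance bounded
    below. *)
Lemma chain_finite : exists H, ~ chain at_zero H.
Proof.
have [h h0 hH] := uniform_modulus y0.
exists (Num.truncn (t / h)).+2 => -[[|u us] [//= [sz] sus tus alt]].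
have := @alternating_spread h above at_zero u us _ alt sus tus.
have sep (v w : R) : 0 <= v <= t -> 0 <= w <= t ->
    above v && at_zero w || at_zero v && above w -> h <= `|v - w|.
  move=> tv tw H; rewrite leNgt; apply/negP => /(hH _ _ tv tw).
  case/orP: H => /andP[]; rewrite /above /at_zero.
    by move=> yv /eqP ->; rewrite subr0 ltNge ltW.
  by move=> /eqP -> yw; rewrite sub0r normrN ltNge ltW.
move=> /(_ sep); rewrite sz.
have := truncnS_gt (t / h); rewrite ltr_pdivrMr // => th.
by move: tus => /= /andP[/andP[u0 _] _]; lra.
Qed.

(** On the compact set of times at distance at least h from the zeros, |b| is
    bounded below. *)
Lemma near_zero_modulus (h : R) : 0 < h -> exists2 e : R, 0 < e &
  forall r : R, 0 <= r <= t -> `|b r| < e ->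
    exists z : R, [/\ 0 <= z <= t, b z = 0 & `|r - z| < h].
Proof.
move=> h0.
have := @segment_compact R 0 t; rewrite compact_near_coveringP => cov.
have [] := cov R (0^'+) (fun e r => 0 <= r <= t -> `|b r| < e ->
    exists z : R, [/\ 0 <= z <= t, b z = 0 & `|r - z| < h]) _.
  move=> u; rewrite /= in_itv /= => tu.
  have [bu|bu] := eqVneq (b u) 0.
    near=> r e.
    have ur : `|u - r| < h by near: r; apply/nbhs_ballP; exists h.
    by move=> /= tr _; exists u; split => //; rewrite distrC.
  have bu0 : 0 < `|b u| / 2 by rewrite divr_gt0 // normr_gt0.
  have [k k0 Hk] := local_modulus u bu0.
  near=> r e.
  have ur : `|u - r| < k by near: r; apply/nbhs_ballP; exists k.
  have eb : e < `|b u| / 2 by near: e; exact: nbhs_right_lt.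
  move=> /= tr bre; exfalso.
  have {}ur : `|b u - b r| < `|b u| / 2 by exact: Hk.
  have : `|b u| <= `|b u - b r| + `|b r|.
    by rewrite -{1}(subrK (b r) (b u)) ler_normD.
  lra.
move=> e /= e0 H; exists (e / 2); first by rewrite divr_gt0.
move=> r tr; apply: (H (e / 2)) => //=.
- by rewrite sub0r normrN ger0_norm; lra.
- by rewrite divr_gt0.
Unshelve. all: by end_near. Qed.

(** Each time at which |b| < e is moved to a zero at distance less than h. The
    order is kept because |b| varies by less than y over h, so that no zero is
    within h of a time at which |b| > y. *)
Lemma chain_below_at_zero : exists2 e0 : R, 0 < e0 &
  forall e r, e <= e0 -> chain (below e) r -> chain at_zero r.
Proof.
have [h h0 hH] := uniform_modulus y0.
have [e0 e0_gt0 He0] := near_zero_modulus h0.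
(* Thresholds up to y, so that a time below e is not above y. *)
exists (Num.min e0 y); first by rewrite lt_min e0_gt0.
move=> e r; rewrite le_min => /andP[ee0 ey] [us [sz sus tus alt]].
pose zero_of u := xget 0 [set z : R | [/\ 0 <= z <= t, b z = 0 & `|u - z| < h]].
have zeroP u : 0 <= u <= t -> below e u ->
    [/\ 0 <= zero_of u <= t, b (zero_of u) = 0 & `|u - zero_of u| < h].
  move=> tu bu; have [z Hz] := He0 u tu (lt_le_trans bu ee0).
  exact: (@xgetPex _ 0 [set z : R | [/\ 0 <= z <= t, b z = 0 & `|u - z| < h]] (ex_intro _ z Hz)).
pose f u := if above u then u else zero_of u.
have belowN u : below e u -> above u = false.
  by rewrite /below /above => bu; apply/negbTE; rewrite -leNgt; lra.
pose p u := above u && (0 <= u <= t); pose q u := below e u && (0 <= u <= t).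
have {}alt : alternating p q us.
  exact: alternating_and.
have far_z u v : p u -> q v -> h <= `|u - zero_of v|.
  move=> /andP[au tu] /andP[bv tv]; rewrite leNgt; apply/negP.
  have [tz bz _] := zeroP v tv bv => /(hH _ _ tu tz).
  by rewrite bz subr0; move: au; rewrite /above; lra.
exists (map f us); split.
- by rewrite size_map.
- apply: (sorted_alternating _ alt sus) => u v uv /orP[] /andP[].
    move=> pu qv; have Hu := far_z u v pu qv.
    move: pu qv => /andP[au tu] /andP[bv tv].
    have [_ _ vz] := zeroP v tv bv; rewrite /f au (belowN v bv) ltNge; apply/negP => zu.
    by move: Hu vz; rewrite !ger0_norm ?subr_ge0 //; lra.
  move=> qu pv; have Hv := far_z v u pv qu.
  move: qu pv => /andP[bu tu] /andP[av tv].
  have [_ _ uz] := zeroP u tu bu; rewrite /f av (belowN u bu) ltNge; apply/negP => vz.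
  move: Hv uz; rewrite !ler0_norm ?subr_le0 //; lra.
- apply/allP => _ /mapP[u us_u ->]; rewrite /f.
  have := allP (alternating_all alt) u us_u; rewrite /p /q.
  by case: (boolP (above u)) => _ /= => [/orP[//|/andP[]//]|/andP[bu tu]]; case: (zeroP u tu bu).
- apply: (alternating_map _ _ alt) => u /andP[].
    by move=> au _; rewrite /f au.
  by move=> bu tu; rewrite /f (belowN u bu) /at_zero; have [_ -> _] := zeroP u tu bu.
Qed.

Lemma common_modulus (e : R) (us : seq R) : exists2 h : R, 0 < h &
  forall u, u \in us -> forall v, `|u - v| < h ->
    (above u -> above v) /\ (below e u -> below e v).
Proof.
have one (u : R) : exists2 h : R, 0 < h & forall v : R, `|u - v| < h ->
    (above u -> above v) /\ (below e u -> below e v).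
  have [k1 k1_gt0 H1] : exists2 h : R, 0 < h & forall v : R, `|u - v| < h -> above u -> above v.
    rewrite /above; have [bu|bu] := ltP y `|b u|; last by exists 1.
    have d0 : 0 < `|b u| - y by rewrite subr_gt0.
    have [h h0 hH] := local_modulus u d0; exists h => // v uv _.
    have := hH v uv; have : `|b u| <= `|b u - b v| + `|b v|.
      by rewrite -{1}(subrK (b v) (b u)) ler_normD.
    lra.
  have [k2 k2_gt0 H2] : exists2 h : R, 0 < h & forall v : R, `|u - v| < h -> below e u -> below e v.
    rewrite /below; have [bu|bu] := ltP `|b u| e; last by exists 1.
    have d0 : 0 < e - `|b u| by rewrite subr_gt0.
    have [h h0 hH] := local_modulus u d0; exists h => // v uv _.
    have := hH v uv; have : `|b v| <= `|b u - b v| + `|b u|.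
      by rewrite distrC -{1}(subrK (b u) (b v)) ler_normD.
    lra.
  exists (Num.min k1 k2); first by rewrite lt_min k1_gt0.
  by move=> v; rewrite lt_min => /andP[uv1 uv2]; split; [exact: H1|exact: H2].
elim: us => [|u us [h h0 hH]]; first by exists 1.
have [k k0 kH] := one u; exists (Num.min h k); first by rewrite lt_min h0.
move=> v; rewrite inE => /orP[/eqP ->|vus] w; rewrite lt_min => /andP[uvh uvk].
  exact: kH.
exact: hH.
Qed.

Definition grid_time n i : R := t * i%:R / 2 ^+ n.

Lemma grid_step_small (h : R) : 0 < h -> exists N, forall n, (N <= n)%N -> t / 2 ^+ n < h.
Proof.
move=> h0; exists (Num.truncn (t / h)).+1 => n Nn.
have := truncnS_gt (t / h); rewrite ltr_pdivrMr // => th.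
rewrite ltr_pdivrMr ?exprn_gt0 // mulrC; apply: lt_trans th _.
rewrite ltr_pM2r // -natrX ltr_nat.
by apply: leq_ltn_trans Nn _; apply: ltn_expl.
Qed.

Lemma grid_time_itv n i : (i <= 2 ^ n)%N -> 0 <= grid_time n i <= t.
Proof.
move=> i2; rewrite /grid_time; apply/andP; split.
  by rewrite divr_ge0 ?mulr_ge0 ?exprn_ge0 ?ler0n // ltW.
by rewrite ler_pdivrMr ?exprn_gt0 // ler_pM2l // -natrX ler_nat.
Qed.

Lemma grid_time_lt n i j : (i < j)%N -> grid_time n i < grid_time n j.
Proof.
by move=> ij; rewrite /grid_time ltr_pM2r ?invr_gt0 ?exprn_gt0 // ltr_pM2l // ltr_nat.
Qed.

Lemma grid_time0 n : grid_time n 0 = 0.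
Proof. by rewrite /grid_time mulr0 mul0r. Qed.

Definition grid_increments n : seq R :=
  mkseq (fun i => b (grid_time n i.+1) - b (grid_time n i)) (2 ^ n).

Definition round_down n (u : R) : R := grid_time n (Num.truncn (u * 2 ^+ n / t)).

Lemma round_down_itv n (u : R) : 0 <= u -> u - t / 2 ^+ n < round_down n u <= u.
Proof.
move=> u0; have two : 0 < 2 ^+ n :> R by rewrite exprn_gt0.
have x0 : 0 <= u * 2 ^+ n / t by rewrite divr_ge0 ?mulr_ge0 // ltW.
rewrite /round_down /grid_time; apply/andP; split.
  have := truncnS_gt (u * 2 ^+ n / t); rewrite ltr_pdivrMr // => H.
  rewrite -[X in X - _](mulfK (lt0r_neq0 two)) -mulrBl ltr_pM2r ?invr_gt0 //.
  by rewrite -natr1 in H; lra.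
rewrite ler_pdivrMr // mulrC.
by have /andP[H _] := truncn_itv x0; move: H; rewrite ler_pdivlMr.
Qed.

Lemma round_down_le n (u v : R) : u <= v -> round_down n u <= round_down n v.
Proof.
move=> uv; rewrite /round_down /grid_time.
rewrite ler_pM2r ?invr_gt0 ?exprn_gt0 // ler_pM2l // ler_nat.
by apply: le_truncn; rewrite ler_pM2r ?invr_gt0 // ler_pM2r ?exprn_gt0.
Qed.

Definition grid_alternations e n : nat :=
  alternations (far y) (near e) (scanl +%R 0 (grid_increments n)).

(** The grid may include the time 0, which is not above y. *)
Lemma grid_alternationsE e n : grid_alternations e n =
  alternations above (below e) (mkseq (grid_time n) (2 ^ n).+1).
Proof.
rewrite /grid_alternations -{1}b0 -(grid_time0 n) scanl_telescope /mkseq /= grid_time0.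
have -> : above 0 = false by rewrite /above b0 normr0 ltNge ltW.
rewrite -[iota 1 _]/(iota (1 + 0) (2 ^ n)) iotaDl -map_comp.
rewrite (_ : [seq b (grid_time n i.+1) | i <- iota 0 (2 ^ n)] =
   map b [seq (grid_time n \o addn 1) i | i <- iota 0 (2 ^ n)]).
  by rewrite alternations_map.
by rewrite -map_comp; apply: eq_map.
Qed.

Lemma sorted_grid n m : sorted <%R (mkseq (grid_time n) m).
Proof.
apply: (homo_sorted (e := ltn)); last exact: iota_ltn_sorted.
by move=> i j; exact: grid_time_lt.
Qed.

Lemma chain_of_grid e n r :
  (r <= grid_alternations e n)%N ->
  chain (below e) r.
Proof.
rewrite grid_alternationsE => rn; apply: (chain_le rn).
have [us [sub alt sz]] := alternations_chain above (below e) (mkseq (grid_time n) (2 ^ n).+1).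
exists us; split => //.
- apply: subseq_sorted sub (sorted_grid _ _); exact: lt_trans.
- apply/allP => u /(mem_subseq sub) /mapP[i]; rewrite mem_iota /= add0n ltnS => i2 ->.
  exact: grid_time_itv.
Qed.

(** Rounding the times of a chain down to a fine grid keeps the strict
    inequalities; it keeps the order because consecutive times, being on different
    sides of y, cannot be rounded to the same point. *)
Lemma grid_of_chain e r : e <= y -> chain (below e) r ->
  exists N, forall n, (N <= n)%N ->
    (r <= grid_alternations e n)%N.
Proof.
move=> ey [us [<- sus tus alt]].
have [h h0 hH] := common_modulus e us.
have [N HN] := grid_step_small h0; exists N => n /HN small.
rewrite grid_alternationsE.
pose k u := (0 <= u <= t) && (u \in us).
have {}alt : alternating (fun u => above u && k u) (fun u => below e u && k u) us.
  apply: alternating_and => //; apply/allP => u uus; rewrite /k uus andbT.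
  by move/allP: tus; exact.
have close u : k u -> (above u -> above (round_down n u)) /\
                      (below e u -> below e (round_down n u)).
  move=> /andP[/andP[u0 ut] uus]; apply: hH => //.
  by have /andP[u1 u2] := round_down_itv n u0; rewrite ger0_norm ?subr_ge0 //; lra.
rewrite -(size_map (round_down n) us); apply: alternations_greedy.
  apply: sorted_lt_subseq; [|exact: sorted_grid|].
    apply: (sorted_alternating _ alt sus) => u v uv pq.
    rewrite lt_neqAle round_down_le ?andbT; last exact: ltW.
    apply/eqP => E.
    case/orP: pq => /andP[/andP[cu ru] /andP[cv rv]].
      have := (close _ ru).1 cu; have := (close _ rv).2 cv; rewrite E /above /below; lra.
    have := (close _ ru).2 cu; have := (close _ rv).1 cv; rewrite E /above /below; lra.
  move=> _ /mapP[u uus ->]; apply/mapP; eexists; last by [].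
  have /andP[u0 ut] : 0 <= u <= t by move/allP: tus; exact.
  rewrite mem_iota /= add0n ltnS -(ler_nat R) natrX.
  have x0 : 0 <= u * 2 ^+ n / t by rewrite divr_ge0 ?mulr_ge0 ?exprn_ge0 // ltW.
  have /andP[H _] := truncn_itv x0; apply: le_trans H _.
  by rewrite ler_pdivrMr // mulrC ler_pM2l ?exprn_gt0.
by apply: (alternating_map _ _ alt) => u /andP[cu ru]; [exact: (close u ru).1|exact: (close u ru).2].
Qed.

Lemma grid_increments_small (e : R) : 0 < e -> exists N, forall n, (N <= n)%N ->
  all (fun s : R => `|s| <= e) (grid_increments n).
Proof.
move=> e0; have [h h0 hH] := uniform_modulus e0.
have [N HN] := grid_step_small h0; exists N => n /HN small.
apply/allP => s /mapP[i]; rewrite mem_iota /= add0n => i2 ->; apply: ltW.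
apply: hH; [exact: grid_time_itv|by apply: grid_time_itv; exact: ltnW|].
rewrite gtr0_norm ?subr_gt0; last exact: grid_time_lt.
rewrite /grid_time -mulrBl -mulrBr -natr1 [_ + 1]addrC addrK mulr1 //.
Qed.
End Path.

(** * Excursions and chains *)

Section ChainSeparation.
Context {R : realType}.
Variables (c : R -> R) (t y : R).
Implicit Types (u v r : R) (us ss : seq R).

Definition zero_between u v : bool := `[< exists r, u < r < v /\ c r = 0 >].

Lemma zero_between_trans : transitive zero_between.
Proof.
move=> v u w /asboolP[r [/andP[ur rv] r0]] /asboolP[r' [/andP[vr' r'w] _]].
by apply/asboolP; exists r; split => //; lra.
Qed.

Lemma zero_between_lt u v : zero_between u v -> u < v.
Proof. by move=> /asboolP[r [/andP[ur rv] _]]; lra. Qed.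

Local Notation above := (above c y).
Local Notation at_zero := (at_zero c).
Local Notation times := (times t).

Lemma chain_interleave u us :
  path zero_between u us -> all above (u :: us) -> times (u :: us) ->
  exists vs, [/\ path <%R u vs, times vs, alternating at_zero above vs &
                size vs = (size us).*2].
Proof.
elim: us u => [|v us IH] u /=; first by exists [::].
move=> /andP[/asboolP[r [/andP[ur rv] r0]] pv] /and3P[au av aus] /and3P[tu tv tus].
have av' : all above (v :: us) by rewrite /= av.
have tv' : times (v :: us) by rewrite /= tv.
have [vs [pvs tvs alt sz]] := IH v pv av' tv'.
exists [:: r, v & vs]; split => /=.
- by rewrite ur rv.
- by rewrite tv /= tvs andbT; move: tu tv => /andP[? ?] /andP[? ?]; lra.
- by rewrite /at_zero r0 eqxx av.
- by rewrite sz.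
Qed.

Lemma chain_extract vs u : path <%R u vs -> times vs -> alternating at_zero above vs ->
  exists us, [/\ path zero_between u us, times us, all above us &
    size us = half (size vs)].
Proof.
elim: {vs}(size vs) {-2}vs (leqnn (size vs)) u => [|n IH] [|r [|v vs]] //= sz u;
  do ?by exists [::].
move=> /and3P[ur rv pv] /and3P[tr tv tvs] /and3P[r0 av alt].
have szvs : (size vs <= n)%N by move: sz; rewrite ltnS => /ltnW.
have [us [pus tus aus szus]] := IH vs szvs v pv tvs alt.
exists (v :: us) => /=; split; rewrite ?tv ?av ?szus //.
by rewrite pus andbT; apply/asboolP; exists r; rewrite ur rv; split => //; apply/eqP.
Qed.

(** A chain amounts to times above y with a zero between any two neighbours. *)
Lemma chain_separated k : chain c t y at_zero (k.+1.*2.-1) <->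
  exists us, [/\ size us = k.+1, sorted zero_between us, times us & all above us].
Proof.
rewrite /=; split.
  move=> [[|u vs] [] //= [sz] pvs /andP[tu tvs] /andP[au alt]].
  have [us [pus tus aus szus]] := chain_extract pvs tvs alt.
  by exists (u :: us); rewrite /= tu au szus sz doubleK.
move=> [[|u us] [] //= [sz] pus tus aus].
have [vs [pvs tvs alt szvs]] := chain_interleave pus aus tus.
exists (u :: vs); rewrite /= szvs sz; split => //.
  by move: tus => /= /andP[-> _].
by move: aus => /= /andP[-> _].
Qed.

End ChainSeparation.

Section ExcursionIntervals.
Context {R : realType}.
Variables (b c : R -> R) (J : nat -> set R) (t y : R).
Hypotheses (cb : forall s : R, 0 <= s -> c s = b s) (y0 : 0 < y).
Hypothesis enumJ : enumerates (excursion_intervals (fun s => `|b s|)) J.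

Let U := [set s : R | 0 <= s /\ `|b s| != 0].

Lemma excursion_component m s : J m s -> [/\ 0 <= s, b s != 0 & J m = connected_component U s].
Proof.
case: enumJ => JS _ _ Jms; have [s0 Us0 E] := JS m (ex_intro _ s Jms).
move: Jms; rewrite -E => cs; have [s_ge0 bs] := connected_component_sub cs.
by split => //; [rewrite -normr_eq0|exact: same_connected_component].
Qed.

Lemma excursion_cover s : 0 <= s -> b s != 0 -> exists m, J m s.
Proof.
move=> s0 bs; case: enumJ => _ _ JS.
have Us : U s by split=> //; rewrite normr_eq0.
have [|m _ E] := JS (connected_component U s); first by exists s.
by exists m; rewrite E; exact: connected_component_refl.
Qed.

Lemma excursion_disjoint m m' s : J m s -> J m' s -> m = m'.
Proof.
case: enumJ => _ Jinj _ Jm Jm'; apply: Jinj; rewrite ?inE /=; [by exists s|by exists s|].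
have [_ _ ->] := excursion_component Jm.
by have [_ _ ->] := excursion_component Jm'.
Qed.

Lemma excursion_nonzero m u v r : J m u -> J m v -> u < r < v -> b r != 0.
Proof.
move=> Ju Jv /andP[ur rv].
have [_ _ E] := excursion_component Ju.
have : is_interval (J m) by apply/connected_intervalP; rewrite E; exact: component_connected.
move=> /(_ u v Ju Jv r); rewrite !ltW // => /(_ isT) Jr.
by have [] := excursion_component Jr.
Qed.

(** The interval [u, v] is connected and contained in the set of nonzero times. *)
Lemma excursion_extend m u v : J m u -> u <= v ->
  (forall r, u <= r <= v -> b r != 0) -> J m v.
Proof.
move=> Ju uv nz; have [u0 _ ->] := excursion_component Ju.
have I : connected `[u, v] by apply/connected_intervalP; exact: interval_is_interval.
apply: (connected_component_max (B := `[u, v]%classic)) => //.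
- by rewrite /= in_itv /= lexx uv.
- move=> r /=; rewrite in_itv /= => uvr; split; last by rewrite normr_eq0 nz.
  by move/andP: uvr => [ur _]; exact: le_trans ur.
- by rewrite /= in_itv /= lexx uv.
Qed.

Lemma large_neq0 s : y < `|b s| -> b s != 0.
Proof. by rewrite -normr_gt0; exact: lt_trans. Qed.

Definition large_excursions : set nat :=
  [set m | exists s, [/\ J m s, 0 <= s <= t & y < `|b s|]].

(** One time above y is chosen in each excursion and the choices are sorted;
    times are in different excursions exactly when a zero separates them. *)
Lemma large_excursions_chain k :
  (exists ms : seq nat, [/\ uniq ms, size ms = k.+1 & {in ms, forall m, large_excursions m}])
  <-> chain c t y (at_zero c) (k.+1.*2.-1).
Proof.
rewrite chain_separated; split.
  move=> [ms [uniqms szms large]].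
  have [f fP] : exists f : nat -> R, forall m, m \in ms ->
      [/\ J m (f m), 0 <= f m <= t & y < `|b (f m)|].
    have H m : exists s, m \in ms -> [/\ J m s, 0 <= s <= t & y < `|b s|].
      by case: (boolP (m \in ms)) => [/large [s Hs]|]; [exists s|exists 0].
    by exists (fun m => projT1 (cid (H m))) => m; case: cid.
  pose us := sort <=%R (map f ms).
  have mem_us u : u \in us -> exists2 m, m \in ms & u = f m.
    by rewrite mem_sort => /mapP[m mms ->]; exists m.
  have uniq_us : uniq us.
    rewrite sort_uniq map_inj_in_uniq // => m m' mms m'ms E.
    have [Jm _ _] := fP _ mms; have [Jm' _ _] := fP _ m'ms.
    by rewrite E in Jm; exact: excursion_disjoint Jm Jm'.
  have sorted_us : sorted <%R us by rewrite lt_sorted_uniq_le uniq_us sort_le_sorted.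
  exists us; split.
  - by rewrite size_sort size_map.
  - apply: (@sub_in_sorted _ (mem us) <%R) sorted_us; last by apply/allP.
    move=> u v uus vus uv; case: (boolP (zero_between c u v)) => // /asboolPn nz; exfalso.
    have [m mms uE] := mem_us u uus; have [m' m'ms vE] := mem_us v vus.
    have [Jm tm ym] := fP _ mms; have [Jm' tm' ym'] := fP _ m'ms.
    rewrite -uE in Jm tm ym; rewrite -vE in Jm' tm' ym'.
    have mm' : m = m'.
      apply: excursion_disjoint Jm'; apply: excursion_extend Jm (ltW uv) _ => r.
      move=> /andP[ur rv]; have r0 : 0 <= r by move: tm => /andP[? _]; lra.
      have [rE|ru] := eqVneq r u; first by rewrite rE large_neq0.
      have [rE|rv'] := eqVneq r v; first by rewrite rE large_neq0.
      apply/eqP => br; apply: nz; exists r; rewrite cb // !lt_neqAle ur rv.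
      by rewrite rv' eq_sym ru.
    by move: uv; rewrite uE vE mm' ltxx.
  - by apply/allP => u /mem_us [m mms ->]; have [] := fP _ mms.
  - apply/allP => u /mem_us [m mms ->]; rewrite /above.
    by have [_ /andP[f0 _] yb] := fP _ mms; rewrite cb.
move=> [us [szus sus tus aus]].
have H u : exists m, u \in us -> J m u.
  case: (boolP (u \in us)) => [uus|]; last by exists 0%N.
  have /andP[u0 _] := allP tus u uus; have := allP aus u uus.
  rewrite /above cb // => yu.
  have [|m Jm] := @excursion_cover u u0; last by exists m.
  exact: large_neq0.
pose f u := projT1 (cid (H u)).
have fP u : u \in us -> J (f u) u by rewrite /f; case: cid.
have sep : pairwise (zero_between c) us.
  by rewrite -sorted_pairwise //; exact: zero_between_trans.
exists (map f us); split; last 1 first.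
- move=> _ /mapP[u uus ->]; exists u; split; [exact: fP|exact: (allP tus)|].
  have /andP[u0 _] := allP tus u uus.
  by have := allP aus u uus; rewrite /above cb.
- rewrite map_inj_in_uniq.
    apply: (@sorted_uniq _ <%R lt_trans ltxx).
    by apply: sub_sorted sus => u v; exact: zero_between_lt.
  move=> u v uus vus E; apply: contrapT => /eqP uv.
  wlog lt : u v uus vus E uv / u < v.
    move=> W; have [|vu|uv'] := ltgtP u v; first exact: W.
      by apply: (W v u) => //; rewrite eq_sym.
    by move: uv; rewrite uv' eqxx.
  have /asboolP[r [urv r0]] : zero_between c u v.
    have /(nthP 0) [i ius uE] := uus; have /(nthP 0) [j jus vE] := vus.
    rewrite -uE -vE in lt *.
    have ij : (i < j)%N.
      rewrite ltnNge; apply/negP => ji; move: lt; rewrite ltNge => /negP; apply.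
      move: ji; rewrite leq_eqVlt => /predU1P[-> //|ji].
      apply: ltW; apply: (zero_between_lt (c := c)).
      by move/(pairwiseP 0): sep; apply.
    by move/(pairwiseP 0): sep; apply.
  have [u0 _ _] := excursion_component (fP u uus).
  have := @excursion_nonzero (f u) u v r (fP u uus) _ urv.
  rewrite -cb ?r0 ?eqxx; last by case/andP: urv => ur _; apply: ltW; exact: le_lt_trans ur.
  by rewrite E => /(_ (fP v vus)).
- by rewrite size_map.
Qed.

End ExcursionIntervals.

(** * Ranked excursion heights *)

(** The j first ranks point to j members above y; conversely j members above y
    occupy j ranks, one of which is at least j. *)
Lemma ranked_gt {R : realType} (D : set nat) (h M : nat -> R) (y : R) j :
  ranked D h M -> 0 <= y -> (1 <= j)%N ->
  y < M j <-> exists ms : seq nat,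
    [/\ uniq ms, size ms = j & {in ms, forall m, D m /\ y < h m}].
Proof.
move=> [M0 Mdec [f [[fD finj fsurj] fM]]] y0 j1; split.
  move=> yMj; exists (map f (iota 1 j)).
  have pos i : i \in iota 1 j -> (1 <= i)%N /\ 0 < M i.
    rewrite mem_iota => /andP[i1 ij]; split => //.
    by apply: lt_le_trans (le_lt_trans y0 yMj) _; apply: Mdec => //; lia.
  split; last 1 first.
  - move=> _ /mapP[i ij ->]; have [i1 Mi] := pos i ij.
    have [Dfi hfi] := fD i (conj i1 Mi); split => //.
    rewrite -fM //; apply: lt_le_trans yMj _; apply: Mdec => //.
    by move: ij; rewrite mem_iota; lia.
  - rewrite map_inj_in_uniq ?iota_uniq // => i i' /pos Hi /pos Hi'.
    by apply: finj; rewrite inE.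
  - by rewrite size_map size_iota.
move=> [ms [uniqms szms msP]].
have H m : exists i, m \in ms -> [/\ (1 <= i)%N, 0 < M i & f i = m].
  case: (boolP (m \in ms)) => [/msP [Dm hm]|]; last by exists 0%N.
  have [|i [i1 Mi] E] := fsurj m; first by split => //; exact: le_lt_trans hm.
  by exists i.
pose g m := projT1 (cid (H m)).
have gP m : m \in ms -> [/\ (1 <= g m)%N, 0 < M (g m) & f (g m) = m].
  by rewrite /g; case: cid.
have ug : uniq (map g ms).
  rewrite map_inj_in_uniq // => m m' mms m'ms E.
  have [_ _ <-] := gP m mms; have [_ _ <-] := gP m' m'ms; by rewrite E.
have [m mms jm] : exists2 m, m \in ms & (j <= g m)%N.
  apply: contrapT => no.
  have : (size (map g ms) <= size (iota 1 j.-1))%N.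
    apply: uniq_leq_size => // _ /mapP[m mms ->]; rewrite mem_iota.
    have [g1 _ _] := gP m mms; rewrite g1 /= ltnNge; apply/negP => jg.
    by apply: no; exists m => //; lia.
  by rewrite size_map szms size_iota; lia.
have [g1 Mg fg] := gP m mms; have [_ hm] := msP m mms.
by apply: lt_le_trans (Mdec _ _ j1 jm); rewrite fM // fg.
Qed.

Section Heights.
Context {R : realType}.
Variables (b c : R -> R) (J : nat -> set R) (A : nat -> R) (t y : R).
Hypotheses (cc : continuous c) (cb : forall s : R, 0 <= s -> c s = b s).
Hypotheses (t0 : 0 < t) (y0 : 0 <= y).
Hypothesis signA : forall m, A m = 1 \/ A m = -1.
Hypothesis enumJ : enumerates (excursion_intervals (fun s => `|b s|)) J.

Let x s := limn (series (fun m => \1_(J m) s * A m * `|b s|)).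

Lemma skew_value m s : J m s -> x s = A m * `|b s|.
Proof.
move=> Jm; apply/cvg_lim => //; apply: cvg_near_cst.
exists m.+1 => // n /= mn; rewrite /series /=.
rewrite (bigD1_seq m) ?iota_uniq ?mem_index_iota //=.
rewrite indicE mem_set // mul1r big1 ?addr0 // => i im.
rewrite indicE memNset ?mul0r // => Ji.
by move/negP: im; apply; apply/eqP; exact: (excursion_disjoint enumJ Ji Jm).
Qed.

Lemma path_bounded : exists K, forall s, 0 <= s <= t -> `|b s| <= K.
Proof.
have ca : {within `[0, t], continuous (fun s => `|c s|)}.
  apply: continuous_subspaceT => s; apply: continuous_comp; first exact: cc.
  exact: norm_continuous.
have [s _ Hs] := EVT_max (ltW t0) ca.
exists `|c s| => u /andP[u0 ut]; rewrite -cb //.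
by apply: Hs; rewrite in_itv /= u0.
Qed.

(** The height of a negative excursion is at most 0, hence not above y >= 0. *)
Lemma excursion_height_gt m :
  (J m `&` `[0, t]) !=set0 /\ y < excursion_height x (J m) t <->
  large_excursions b J t y m /\ A m = 1.
Proof.
have mem s : (J m `&` `[0, t]) s <-> J m s /\ 0 <= s <= t by rewrite /= in_itv.
split.
  move=> [ne yh].
  have [E|E] := signA m; last first.
    exfalso; move: yh; rewrite ltNge => /negP; apply; apply: le_trans y0.
    apply: ge_sup; first by case: ne => s Hs; exists (x s); exists s.
    move=> _ [s /mem[Js ts] <-]; rewrite (skew_value Js) E mulN1r oppr_le0 //.
  split => //; apply: contrapT => small.
  move: yh; rewrite ltNge => /negP; apply.
  apply: ge_sup; first by case: ne => s Hs; exists (x s); exists s.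
  move=> _ [s /mem[Js ts] <-]; rewrite (skew_value Js) E mul1r leNgt; apply/negP => ys.
  by apply: small; exists s.
move=> [[s [Js ts ys]] E]; split; first by exists s; apply/mem.
apply: (lt_le_trans ys); rewrite -[leLHS]mul1r -E -(skew_value Js).
apply: ub_le_sup; last by exists s => //; apply/mem.
have [K HK] := path_bounded; exists K => _ [u /mem[Ju tu] <-].
by rewrite (skew_value Ju) E mul1r; exact: HK.
Qed.

Lemma ranked_height_gt M j : (1 <= j)%N -> ranked_excursion_heights x J t M ->
  y < M j <-> exists ms : seq nat, [/\ uniq ms, size ms = j &
    {in ms, forall m, large_excursions b J t y m /\ A m = 1}].
Proof.
move=> j1 /ranked_gt /(_ y0 j1) ->; split=> -[ms [ums sms H]]; exists ms; split => // m mms.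
  by apply/excursion_height_gt; exact: H.
by apply/excursion_height_gt; exact: H.
Qed.

End Heights.

(** * Thinning by independent signs *)

Lemma measurable_count d (T : measurableType d) (I : eqType) (q : I -> T -> bool) (s : seq I) j :
  (forall i, i \in s -> measurable [set w | q i w]) ->
  measurable [set w | (j <= count (q ^~ w) s)%N].
Proof.
elim: s j => [|i s IH] j mq.
  case: j => [|j] /=; first by rewrite (_ : [set _ | _] = setT) //; apply/seteqP; split.
  by rewrite (_ : [set _ | _] = set0) //; apply/seteqP; split.
have mi : measurable [set w | q i w] by apply: mq; rewrite mem_head.
have ms k : measurable [set w | (k <= count (q ^~ w) s)%N].
  by apply: IH => i' i's; apply: mq; rewrite inE i's orbT.
rewrite (_ : [set _ | _] =
  ([set w | q i w] `&` [set w | (j.-1 <= count (q ^~ w) s)%N]) `|`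
  (~` [set w | q i w] `&` [set w | (j <= count (q ^~ w) s)%N])).
  by apply: measurableU; apply: measurableI => //; exact: measurableC.
apply/seteqP; split=> w /=.
  by case: (boolP (q i w)) => qi; [left; split => //; lia|right; split => //; exact/negP].
case=> [[-> ]|[/negP/negbTE -> //]]; lia.
Qed.

Section Thinning.
Context d (T : measurableType d) (R : realType) (P : probability T R).
Local Notation prob := (prob P).

Lemma prob_fibers (I : finType) (g : T -> I) (E : T -> bool) :
  (forall i, measurable [set w | E w && (g w == i)]) ->
  prob [set w | E w] = \sum_i prob [set w | E w && (g w == i)].
Proof.
move=> mEg.
have EU : [set w | E w] = \big[setU/set0]_(i <- enum I) [set w | E w && (g w == i)].
  rewrite -bigcup_seq; apply/seteqP; split => w /=.
    by move=> Ew; exists (g w); rewrite /= ?mem_enum ?Ew ?eqxx.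
  by case=> i _ /=; case/andP.
have mE : measurable [set w | E w].
  by rewrite EU; apply: bigsetU_measurable.
apply: EFin_inj; rewrite -integral_bool // -sumEFin.
rewrite (eq_bigr (fun i => \int[P]_w ((E w && (g w == i))%:R)%:E)%E); last first.
  by move=> i _; rewrite integral_bool.
rewrite -ge0_integral_sum //.
- apply: eq_integral => w _; rewrite sumEFin (bigD1 (g w)) //= eqxx andbT.
  rewrite big1 ?addr0 // => i ig; rewrite eq_sym (negbTE ig) andbF //.
- by move=> i; apply/measurable_EFinP; exact: measurable_bool.
Qed.

Variables (alpha : R) (A : nat -> T -> R).
Hypothesis mA : forall m, measurable_fun setT (A m).
Hypothesis probA : forall m, P [set w | A m w = 1] = alpha%:E.
Hypothesis indepA : mutually_independent P A.

Definition heads m w := A m w == 1.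

Lemma measurable_heads m : measurable [set w | heads m w].
Proof.
rewrite (_ : [set w | _] = A m @^-1` [set 1]).
  by rewrite -[X in measurable X]setTI; exact: mA.
by apply/seteqP; split => w /= /eqP.
Qed.

(** The induction on s2 decides the signs one at a time; the decided ones are
    collected in s1 with the constraints C, to which mutual independence
    applies. *)
Lemma prob_heads_count_gen (s1 s2 : seq nat) (C : nat -> set R) j :
  uniq (s1 ++ s2) -> (forall i, measurable (C i)) ->
  prob ((\bigcap_(i in [set` s1]) A i @^-1` C i) `&`
        [set w | (j <= count (heads ^~ w) s2)%N]) =
  (\prod_(i <- s1) prob (A i @^-1` C i)) * binomial_tail alpha j (size s2).
Proof.
have base (s : seq nat) (C' : nat -> set R) : uniq s -> (forall i, measurable (C' i)) ->
    prob (\bigcap_(i in [set` s]) A i @^-1` C' i) = \prod_(i <- s) prob (A i @^-1` C' i).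
  move=> us mC; rewrite {1}/prob indepA // -[RHS]/(fine (_%:E)) -prodEFin.
  congr fine; apply: eq_bigr => i _; rewrite probE //.
  by rewrite -[X in measurable X]setTI; exact: mA.
have mcap (s : seq nat) C' : (forall i, measurable (C' i)) ->
    measurable (\bigcap_(i in [set` s]) A i @^-1` C' i).
  move=> mC; apply: fin_bigcap_measurable => [|i _]; first exact: finite_seq.
  by rewrite -[X in measurable X]setTI; exact: mA.
have mcount s k : measurable [set w | (k <= count (heads ^~ w) s)%N].
  by apply: measurable_count => i _; exact: measurable_heads.
elim: s2 s1 C j => [|m s IH] s1 C j us mC.
  rewrite cats0 in us; case: j => [|j] /=.
    rewrite mulr1 -base //; congr prob.
    by apply/seteqP; split => w /=; [case|split].
  rewrite mulr0 (_ : _ `&` _ = set0) /prob ?measure0 //.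
  by apply/seteqP; split => w // [_].
case: j => [|j].
  rewrite binomial_tail0 mulr1 -base //; last by move: us; rewrite cat_uniq => /andP[].
  congr prob.
  by apply/seteqP; split => w /=; [case|split].
pose C' (D : set R) i := if i == m then D else C i.
have mC' D : measurable D -> forall i, measurable (C' D i).
  by move=> mD i; rewrite /C'; case: ifP.
have ms1 : m \notin s1.
  by move: us; rewrite cat_uniq => /and3P[_ /hasPn H _]; apply: H; rewrite mem_head.
have us' : uniq ((m :: s1) ++ s).
  by move: us; rewrite -cat1s (perm_uniq (permEl (perm_catCA s1 [:: m] s))).
have capC D : \bigcap_(i in [set` m :: s1]) A i @^-1` C' D i =
   (\bigcap_(i in [set` s1]) A i @^-1` C i) `&` A m @^-1` D.
  apply/seteqP; split => w /=.
    move=> H; split; last by have := H m; rewrite /= mem_head /C' eqxx => /(_ isT).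
    move=> i /= is1; have := H i; rewrite /= inE is1 orbT /C' => /(_ isT).
    by case: eqP => // im; move: ms1; rewrite -im is1.
  move=> [H Dm] i /=; rewrite inE /C' => /orP[/eqP ->|is1]; first by rewrite eqxx.
  by case: eqP => [->|_] //; exact: H.
have prodC D : \prod_(i <- m :: s1) prob (A i @^-1` C' D i) =
    prob (A m @^-1` D) * \prod_(i <- s1) prob (A i @^-1` C i).
  rewrite big_cons {1}/C' eqxx; congr (_ * _).
  rewrite !big_seq; apply: eq_bigr => i is1; rewrite /C'.
  by case: eqP => // im; move: ms1; rewrite -im is1.
have m1 : measurable ([set 1] : set R) by exact: measurable_set1.
have pH : prob (A m @^-1` [set 1]) = alpha.
  by rewrite /prob -[A m @^-1` _]/([set w | A m w = 1]) probA.
have pT : prob (A m @^-1` ~` [set 1]) = 1 - alpha.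
  rewrite -preimage_setC /prob probability_setC.
    by rewrite -[A m @^-1` _]/([set w | A m w = 1]) probA.
  by rewrite -[X in measurable X]setTI; exact: mA.
rewrite (_ : _ `&` _ =
   ((\bigcap_(i in [set` m :: s1]) A i @^-1` C' [set 1] i) `&`
     [set w | (j <= count (heads ^~ w) s)%N]) `|`
   ((\bigcap_(i in [set` m :: s1]) A i @^-1` C' (~` [set 1]) i) `&`
     [set w | (j.+1 <= count (heads ^~ w) s)%N])); last first.
  rewrite !capC; apply/seteqP; split => w /=; rewrite /heads.
    by move=> [H]; case: eqP => Am cnt; [left|right].
  by move=> [[[H ->]]|[[H /eqP/negbTE ->]]] cnt; rewrite ?eqxx.
rewrite /prob measureU.
- rewrite fineD ?fin_num_measure //; last 2 first.
  + by apply: measurableI => //; apply: mcap; exact: mC'.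
  + by apply: measurableI => //; apply: mcap; apply: mC'; exact: measurableC.
  rewrite -/(prob _) -/(prob _) !IH //; last 2 first.
  + by apply: mC'; exact: measurableC.
  + exact: mC'.
  rewrite !prodC pH pT /=; ring.
- by apply: measurableI => //; apply: mcap; exact: mC'.
- by apply: measurableI => //; apply: mcap; apply: mC'; exact: measurableC.
- by rewrite !capC; apply/seteqP; split => w //= [[[_ Am] _] [[_ /(_ Am)]]].
Qed.

Lemma prob_heads_count (s : seq nat) j : uniq s ->
  prob [set w | (j <= count (heads ^~ w) s)%N] = binomial_tail alpha j (size s).
Proof.
move=> us; have := @prob_heads_count_gen [::] s (fun=> setT) j us (fun=> measurableT).
rewrite big_nil mul1r => <-; congr prob; apply/seteqP; split => w /= Hw; [split|by case: Hw] => //.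
Qed.

Lemma heads_count_generated (s : seq nat) j :
  sigma_generated setT A [set w | (j <= count (heads ^~ w) s)%N].
Proof.
pose G := \bigcup_(i in [set: nat]) preimage_set_system setT (A i) measurable.
apply: (@measurable_count _ (g_sigma_algebraType G)) => m _.
apply: sub_sigma_algebra; exists m => //; exists [set 1]; first exact: measurable_set1.
by rewrite setTI; apply/seteqP; split => w /= /eqP.
Qed.

Variables (G : set (set T)) (q : nat -> T -> bool) (n : nat).
Hypothesis GT : G `<=` measurable.
Hypothesis indepAG : independent_systems P (sigma_generated setT A) <<s G >>.
Hypothesis mq : forall m, <<s G >> [set w | q m w].

Let selected w : {set 'I_n} := [set m : 'I_n | q m w].

Let count_selected w (f : nat -> bool) :
  count (fun m => q m w && f m) (iota 0 n) = count f (map val (enum (selected w))).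
Proof.
have -> : enum (selected w) = [seq i <- enum 'I_n | i \in selected w] by rewrite enumT.
rewrite -val_enum_ord !(count_map (@nat_of_ord n)) [RHS]count_filter.
by apply: eq_count => i /=; rewrite inE andbC.
Qed.

(** Split according to the set of selected indices, which is independent of the
    signs; on each part the number of heads among the selected is binomial. Summing
    the tail by parts brings out the probabilities of having at least k selected
    indices. *)
Lemma thinned_count j :
  prob [set w | (j < count (fun m => q m w && heads m w) (iota 0 n))%N] =
  \sum_(1 <= k < n.+1) binomial_tail_step alpha j.+1 k *
     prob [set w | (k <= count (q ^~ w) (iota 0 n))%N].
Proof.
have sub X : <<s G >> X -> measurable X.
  by apply: smallest_sub => //; exact: sigma_algebra_measurable.
have sel (f : {set 'I_n}) : <<s G >> [set w | selected w == f].
  rewrite (_ : [set w | _] =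
      \bigcap_(m in [set: 'I_n]) [set w | q m w == (m \in f)]); last first.
    apply/seteqP; split => w /=; first by move=> /eqP <- m _; rewrite /= inE.
    by move=> H; apply/eqP/setP => m; rewrite inE; apply/eqP; exact: H.
  apply: (@fin_bigcap_measurable _ (g_sigma_algebraType G)) => // m _.
  case: (m \in f).
    rewrite (_ : [set w | _] = [set w | q m w]); first exact: mq.
    by apply/seteqP; split => w /= /eqP.
  rewrite (_ : [set w | _] = ~` [set w | q m w]); last first.
    by apply/seteqP; split => w /=; [move/eqP/negbT/negP|move/negP/negbTE ->].
  by apply: (@measurableC _ (g_sigma_algebraType G)); exact: mq.
have selH (f : {set 'I_n}) k : <<s G >> [set w | (k <= #|f|)%N && (selected w == f)].
  case: (k <= _)%N; first exact (sel f).
  by rewrite (_ : [set w | _] = set0) //; [exact: sigma_algebra0|apply/seteqP; split].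
rewrite (prob_fibers (g := selected)); last first.
  move=> f; rewrite (_ : [set w | _] =
     [set w | (j < count (heads ^~ w) (map val (enum f)))%N] `&` [set w | selected w == f]).
    apply: measurableI; last exact (sub _ (sel f)).
    by apply: measurable_count => m _; exact: measurable_heads.
  apply/seteqP; split => w /=.
    by move=> /andP[+ /eqP E]; rewrite count_selected E.
  by move=> [+ /eqP E]; rewrite count_selected E eqxx andbT.
transitivity (\sum_(f : {set 'I_n}) \sum_(1 <= k < n.+1)
    binomial_tail_step alpha j.+1 k * prob [set w | (k <= #|f|)%N && (selected w == f)]).
  apply: eq_bigr => f _.
  rewrite (_ : [set w | _] =
     [set w | (j < count (heads ^~ w) (map val (enum f)))%N] `&` [set w | selected w == f]); last first.
    apply/seteqP; split => w /=.
      by move=> /andP[+ /eqP E]; rewrite count_selected E.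
    by move=> [+ /eqP E]; rewrite count_selected E eqxx andbT.
  rewrite {1}/prob indepAG; [|exact: heads_count_generated|exact (sel f)].
  rewrite fineM ?fin_num_measure //; last 2 first.
  - by apply: measurable_count => m _; exact: measurable_heads.
  - exact (sub _ (sel f)).
  rewrite -/(prob _) -/(prob _) prob_heads_count; last first.
    by rewrite map_inj_uniq ?enum_uniq //; exact: val_inj.
  rewrite size_map -cardE.
  have fn : minn n #|f| = #|f| by apply/minn_idPr; rewrite -[X in (_ <= X)%N](card_ord n) max_card.
  rewrite -fn binomial_tail_minn fn mulr_suml; apply: eq_bigr => k _.
  rewrite -mulrA; congr (_ * _); case: (k <= _)%N => /=; first by rewrite mul1r.
  by rewrite mul0r /prob (_ : [set w | _] = set0) ?measure0 //; apply/seteqP; split.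
rewrite exchange_big /=; apply: eq_bigr => k _; rewrite -mulr_sumr; congr (_ * _).
have cnt w : count (q ^~ w) (iota 0 n) = #|selected w|.
  have := count_selected w predT; rewrite count_predT size_map -cardE => <-.
  by apply: eq_count => m; rewrite andbT.
rewrite [RHS](prob_fibers (g := selected)).
  apply: eq_bigr => f _; congr prob; apply/seteqP; split => w /=;
    by rewrite cnt => /andP[+ /eqP E]; rewrite E eqxx andbT.
move=> f; rewrite (_ : [set w | _] = [set w | (k <= #|f|)%N && (selected w == f)]).
  exact (sub _ (selH f k)).
by apply/seteqP; split => w /=; rewrite cnt => /andP[+ /eqP E]; rewrite E eqxx andbT.
Qed.

End Thinning.

(** * Exchange of the two sums *)

Section ThinningSeries.
Context {R : realType}.
Implicit Types (a rho : R) (p f : nat -> R).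

(** With p k = P (N >= k), E v(a, j+1, N) is the sum of the p k weighted by the
    steps of the tail. Truncated at H, the double sum over h and k is finite and
    may be exchanged; the truncation costs a multiple of p H, and the terms with
    h >= N are bounded by those of the series of |c_h|. *)
Lemma thinned_series_bound a j p f pj N rho : 0 <= a -> a <= 1 -> (0 < N)%N ->
  (forall k, 0 <= p k <= 1) ->
  (forall h H, \sum_(1 <= k < H.+1) binomial_tail_step 2^-1 h.+1 k * p k <= f h.+1 <=
     \sum_(1 <= k < H.+1) binomial_tail_step 2^-1 h.+1 k * p k + p H) ->
  (forall H, \sum_(1 <= k < H.+1) binomial_tail_step a j.+1 k * p k <= pj <=
     \sum_(1 <= k < H.+1) binomial_tail_step a j.+1 k * p k + p H) ->
  p n @[n --> \oo] --> 0 ->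
  (forall H, \sum_(N <= h < H) `|thinning_coef a j.+1 h| <= rho) ->
  `|pj - \sum_(1 <= h < N) thinning_coef a j.+1 h * f h| <= rho.
Proof.
move=> a0 a1 N0 p01 Hf Hp p_cvg Hrho.
pose c h := thinning_coef a j.+1 h.
pose S h H := \sum_(1 <= k < H.+1) binomial_tail_step 2^-1 h k * p k.
(* The factor of p H collects the truncation errors of pj and of the f h. *)
pose K := 1 + \sum_(1 <= h < N) `|c h|.
suff bound H : (N <= H)%N -> `|pj - \sum_(1 <= h < N) c h * f h| <= rho + p H * K.
  have : (fun H => rho + p H * K) @ \oo --> rho + 0 * K.
    by apply: cvgD; [exact: cvg_cst|apply: cvgMr_tmp; exact: p_cvg].
  rewrite mul0r addr0 => lim.
  rewrite -(cvg_lim _ lim) //; apply: limr_ge; first by apply/cvg_ex; exists rho.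
  by exists N => // H /= NH; exact: bound.
move=> NH.
pose V := \sum_(1 <= k < H.+1) binomial_tail_step a j.+1 k * p k.
have VE : V = \sum_(1 <= h < H.+1) c h * S h H.
  transitivity (\sum_(1 <= k < H.+1) \sum_(1 <= h < H.+1) c h * (binomial_tail_step 2^-1 h k * p k)).
    rewrite /V !big_nat; apply: eq_bigr => k /andP[k1 kH].
    rewrite binomial_tail_step_thinning // mulr_suml.
    rewrite [RHS](big_cat_nat (n := k.+1)) //=.
    rewrite [X in _ = _ + X]big_nat [X in _ = _ + X]big1 ?addr0.
      by apply: eq_bigr => h _; rewrite mulrA.
    move=> h /andP[kh _]; rewrite /binomial_tail_step bin_small ?mul0r ?mulr0 //; lia.
  by rewrite exchange_big /=; apply: eq_bigr => h _; rewrite mulr_sumr.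
have S01 h : (0 < h)%N -> 0 <= S h H <= 1.
  case: h => // h _; apply/andP; split.
    apply: sumr_ge0 => k _; rewrite mulr_ge0 //; last by case/andP: (p01 k).
    by apply: binomial_tail_step_ge0; lra.
  apply: (@le_trans _ _ (binomial_tail 2^-1 h.+1 H)).
    rewrite binomial_tail_sum; apply: ler_sum => k _.
    rewrite ler_piMr //; last by case/andP: (p01 k).
    by apply: binomial_tail_step_ge0; lra.
  by have /andP[] : 0 <= binomial_tail (2^-1 : R) h.+1 H <= 1 by apply: binomial_tail_bound; lra.
have split_V : V = \sum_(1 <= h < N) c h * S h H + \sum_(N <= h < H.+1) c h * S h H.
  by rewrite VE (big_cat_nat (n := N)) //=; lia.
rewrite (_ : pj - _ = (pj - V) + \sum_(N <= h < H.+1) c h * S h H -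
   \sum_(1 <= h < N) c h * (f h - S h H)); last first.
  rewrite split_V; under [X in _ = _ - X]eq_bigr do rewrite mulrBr.
  rewrite sumrB; ring.
have p0 : 0 <= p H by case/andP: (p01 H).
have b1 : `|pj - V| <= p H.
  by have /andP[l u] := Hp H; rewrite -/V in l u; rewrite ger0_norm ?subr_ge0 //; lra.
have b2 : `|\sum_(N <= h < H.+1) c h * S h H| <= rho.
  apply: le_trans (ler_norm_sum _ _ _) _; apply: le_trans (Hrho H.+1).
  rewrite !big_nat; apply: ler_sum => h /andP[Nh _].
  have /andP[s0 s1] := S01 h (leq_trans N0 Nh).
  by rewrite normrM (ger0_norm s0) ler_piMr.
have b3 : `|\sum_(1 <= h < N) c h * (f h - S h H)| <= p H * \sum_(1 <= h < N) `|c h|.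
  apply: le_trans (ler_norm_sum _ _ _) _; rewrite mulr_sumr !big_nat.
  apply: ler_sum => -[//|h] _; rewrite normrM mulrC ler_wpM2r //.
  by have /andP[l u] := Hf h H; rewrite ger0_norm ?subr_ge0 // lerBlDl.
apply: le_trans (ler_normB _ _) _; apply: le_trans (lerD (ler_normD _ _) (lexx _)) _.
rewrite /K mulrDr mulr1; lra.
Qed.

(** The partial sums of the negative binomial law are at most 1; Pascal's rule
    reduces j+1 to j. *)
Lemma negative_binomial_sum_le rho j n : 0 <= rho -> rho < 1 ->
  (1 - rho) ^+ j.+1 * (\sum_(0 <= i < n) 'C(i, j)%:R * rho ^+ (i - j)) <= 1.
Proof.
move=> r0 r1; pose s j n := \sum_(0 <= i < n) 'C(i, j)%:R * rho ^+ (i - j).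
have s_ge0 j' n' : 0 <= s j' n'.
  by apply: sumr_ge0 => i _; rewrite mulr_ge0 ?exprn_ge0.
have s0 n' : (1 - rho) * s 0%N n' <= 1.
  suff -> : (1 - rho) * s 0%N n' = 1 - rho ^+ n' by rewrite lerBlDr lerDl exprn_ge0.
  elim: n' => [|n' IH]; first by rewrite /s big_geq // mulr0 expr0 subrr.
  rewrite /s big_nat_recr //= mulrDr -/(s 0%N n') IH bin0 subn0 exprS; ring.
have sS j' n' : (1 - rho) * s j'.+1 n' <= s j' n'.
  case: n' => [|n']; first by rewrite /s !big_geq // mulr0.
  have mono : s j' n' <= s j' n'.+1.
    by rewrite /s big_nat_recr //= lerDl mulr_ge0 ?exprn_ge0.
  have mono' : s j'.+1 n' <= s j'.+1 n'.+1.
    by rewrite /s [leRHS]big_nat_recr //= lerDl mulr_ge0 ?exprn_ge0.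
  have E : s j'.+1 n'.+1 = rho * s j'.+1 n' + s j' n'.
    rewrite /s big_nat_recl //= bin0n mul0r add0r mulr_sumr -big_split /=.
    apply: eq_bigr => i _; rewrite binS natrD mulrDl subSS; congr (_ + _).
    have [ij|ji] := ltnP j' i; last by rewrite bin_small // !mul0r mulr0.
    by rewrite (_ : (i - j' = (i - j'.+1).+1)%N) ?exprS; [ring|lia].
  have : rho * s j'.+1 n' <= rho * s j'.+1 n'.+1 by rewrite ler_wpM2l.
  lra.
rewrite -/(s j n); elim: j n => [|j IH] n; first by rewrite expr1.
rewrite exprSr -mulrA; apply: le_trans (IH n).
by rewrite ler_wpM2l // exprn_ge0 // subr_ge0 ltW.
Qed.

Lemma thinning_coef_summable a j : 0 < a -> a < 1 ->
  exists rho : nat -> R, rho n @[n --> \oo] --> 0 /\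
    forall n H, \sum_(n <= h < H) `|thinning_coef a j.+1 h| <= rho n.
Proof.
move=> a0 a1; pose u h := `|thinning_coef a j.+1 h|.
pose r := `|1 - 2 * a|.
have r0 : 0 <= r by exact: normr_ge0.
have r1 : r < 1 by rewrite /r ltr_norml; lra.
pose K := u 0%N + (2 * a) ^+ j.+1 / (1 - r) ^+ j.+1.
have ub n : series u n <= K.
  have r1' : 0 < (1 - r) ^+ j.+1 by rewrite exprn_gt0 // subr_gt0.
  have a2 : 0 <= (2 * a) ^+ j.+1 by rewrite exprn_ge0; lra.
  rewrite /series /=; case: n => [|n].
    by rewrite big_geq //; apply: addr_ge0; [exact: normr_ge0|apply: divr_ge0 => //; exact: ltW].
  rewrite big_nat_recl // lerD2l.
  rewrite (eq_bigr (fun i => (2 * a) ^+ j.+1 * ('C(i, j)%:R * r ^+ (i - j)))); last first.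
    move=> i _; rewrite /u /thinning_coef /= !normrM normrX subSS.
    by rewrite (ger0_norm a2) (ger0_norm (ler0n _ _)) mulrC.
  rewrite -mulr_sumr ler_wpM2l // -[leRHS]mul1r ler_pdivlMr // mulrC.
  exact: negative_binomial_sum_le.
have nd : nondecreasing_seq (series u).
  by apply/nondecreasing_seqP => n; rewrite seriesSr lerDl; exact: normr_ge0.
have bd : has_ubound (range (series u)) by exists K => _ [n _ <-].
have cv := nondecreasing_is_cvgn nd bd.
exists (fun n => limn (series u) - series u n); split.
  by rewrite -[X in _ --> X](subrr (limn (series u))); apply: cvgB => //; exact: cvg_cst.
move=> n H; have [Hn|nH] := leqP H n.
  by rewrite big_geq // subr_ge0; exact: nondecreasing_cvgn_le.
rewrite lerBrDl -[X in X + _]/(\sum_(0 <= h < n) u h) -big_cat_nat //=; last exact: ltnW.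
exact: (nondecreasing_cvgn_le nd cv H).
Qed.

End ThinningSeries.

(** * Large excursions of Brownian motion *)

(** Extending by the value at 0 turns a path on the half-line into a continuous
    function on R. *)
Lemma continuous_extend {R : realType} (f : R -> R) :
  {within `[0, +oo[, continuous f} -> continuous (fun s : R => f (Num.max 0 s)).
Proof.
move=> /subspace_continuousP cf s; apply/cvgrPdist_lt => e e0.
have s0 : (`[0, +oo[%classic : set R) (Num.max 0 s).
  by rewrite /= in_itv /= andbT le_max lexx.
have /cvgrPdist_lt/(_ e e0) := cf _ s0.
rewrite near_withinE => /nbhs_ballP[h /= h0 H].
apply/nbhs_ballP; exists h => //= v sv; apply: H; last first.
  by rewrite /= in_itv /= andbT le_max lexx.
rewrite /ball /=; apply: le_lt_trans sv.
by rewrite /Num.max; case: ltP => ?; case: ltP => ?; rewrite ?subrr ?sub0r ?subr0;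
  rewrite ler_norml; apply/andP; split; have := ler_norm (s - v); have := ler_norm (v - s); rewrite distrC; lra.
Qed.

Lemma cvg_sum_seq {R : realType} (I : Type) (r : seq I) (f : I -> nat -> R) (l : I -> R) :
  (forall i, f i n @[n --> \oo] --> l i) ->
  (\sum_(i <- r) f i n) @[n --> \oo] --> \sum_(i <- r) l i.
Proof.
move=> fl; elim: r => [|i r IH].
  by under eq_fun do rewrite big_nil; rewrite big_nil; exact: cvg_cst.
by under eq_fun do rewrite big_cons; rewrite big_cons; exact: cvgD.
Qed.

Section BrownianExcursions.
Context d (T : measurableType d) (R : realType) (P : probability T R).
Variables (B : R -> {RV P >-> R}) (t y : R).
Hypotheses (hB : standard_brownian_motion B) (t0 : 0 < t) (y0 : 0 < y).
Local Notation prob := (prob P).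

Definition extended_path w (s : R) : R := B (Num.max 0 s) w.
Local Notation path := extended_path.

Lemma extended_pathE w s : 0 <= s -> path w s = B s w.
Proof. by move=> s0; rewrite /path max_r. Qed.

Lemma continuous_path w : continuous (path w).
Proof. exact: (continuous_extend (@bm_continuous _ _ _ _ _ hB w)). Qed.

Lemma path0 w : path w 0 = 0.
Proof. by rewrite extended_pathE // (bm_start hB). Qed.

Definition increment n i : T -> R := B (grid_time t n i.+1) \- B (grid_time t n i).

Lemma grid_time_ge0 n i : 0 <= grid_time t n i.
Proof. by rewrite /grid_time divr_ge0 ?mulr_ge0 ?exprn_ge0 // ltW. Qed.

Lemma grid_incrementsE n w :
  grid_increments (path w) t n = mkseq (fun i => increment n i w) (2 ^ n).
Proof.
by apply: eq_map => i; rewrite !extended_pathE ?grid_time_ge0.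
Qed.

Lemma measurable_increment n i : measurable_fun setT (increment n i).
Proof. by apply: measurable_funB. Qed.

Lemma independent_increments n : mutually_independent P (increment n).
Proof.
apply: (bm_independent_increments hB); first exact: grid_time_ge0.
by apply/nondecreasing_seqP => i; apply: ltW; apply: grid_time_lt.
Qed.

Lemma symmetric_increments n i (C : set R) : measurable C ->
  P [set w | C (- increment n i w)] = P (increment n i @^-1` C).
Proof.
move=> mC; have lt_gt : grid_time t n i < grid_time t n i.+1 by apply: grid_time_lt.
have mC' : measurable (-%R @^-1` C).
  by rewrite -[X in measurable X]setTI; exact: oppr_measurable.
rewrite (bm_gaussian_increments hB (grid_time_ge0 n i) lt_gt mC).
have sd : Num.sqrt (grid_time t n i.+1 - grid_time t n i) != 0.
  by rewrite gt_eqF // sqrtr_gt0 subr_gt0.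
rewrite -(normal_prob_opp sd mC).
by rewrite -(bm_gaussian_increments hB (grid_time_ge0 n i) lt_gt mC').
Qed.

Lemma sum_increments n w : \sum_(i < 2 ^ n) increment n i w = B t w.
Proof.
rewrite -(big_mkord xpredT (fun i => increment n i w)).
rewrite (telescope_sumr_eq (fun i => B (grid_time t n i) w)) //.
rewrite grid_time0 (bm_start hB) subr0; congr (B _ w).
by rewrite /grid_time natrX mulfK // expf_neq0.
Qed.

Lemma prob_endpoint c : prob [set w | c <= B t w] = 1 - std_normal_cdf (c / Num.sqrt t).
Proof.
have mray : measurable (`[c, +oo[%classic : set R) by exact: measurable_itv.
have := bm_gaussian_increments hB (lexx 0) t0 mray.
rewrite subr0 normal_prob_upper ?sqrtr_gt0 // /prob => E.
rewrite -[RHS]/(fine (_%:E)) -E; congr (fine (P _)).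
by apply/seteqP; split => w /=; rewrite in_itv /= andbT (bm_start hB) subr0.
Qed.

Definition chain_event (q : (R -> R) -> pred R) k : set T :=
  [set w | chain (path w) t y (q (path w)) k.*2.-1].

Definition grid_event (e : R) n k : set T :=
  [set w | (k <= excursion_count y e (mkseq (fun i => increment n i w) (2 ^ n)))%N].

Lemma measurable_grid_event (e : R) n k : measurable (grid_event e n k).
Proof. exact: (@measurable_excursion_count _ _ _ _ _ _ _ _ _ (measurable_increment n)). Qed.

Lemma grid_event_cvg (e : R) k : 0 < e -> e <= y ->
  eventually_equal (fun n => grid_event e n k) (chain_event (fun c => below c e) k).
Proof.
move=> e0 ey w.
have E n : grid_event e n k w = (k.*2.-1 <= grid_alternations (path w) t y e n)%N :> Prop.
  by rewrite /grid_event /= -grid_incrementsE /excursion_count uphalf_geq.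
case: (pselect (chain_event (fun c => below c e) k w)) => ch.
  have [N HN] := grid_of_chain (@continuous_path w) (path0 w) t0 y0 ey ch.
  by exists N => n /HN Hn; rewrite E; split.
exists 0%N => n _; rewrite E; split => // H.
exact: (chain_of_grid (path0 w) t0 _ H).
Qed.

Lemma measurable_chain_below (e : R) k : 0 < e -> e <= y ->
  measurable (chain_event (fun c => below c e) k).
Proof.
move=> e0 ey; apply: measurable_eventually (grid_event_cvg k e0 ey) => n.
exact: measurable_grid_event.
Qed.

(** A sequence of thresholds in ]0, y] that tends to 0. *)
Definition shrinking r : R := y / r.+1%:R.

Lemma shrinking_itv r : 0 < shrinking r <= y.
Proof.
rewrite /shrinking divr_gt0 //= ler_pdivrMr // -[leLHS]mulr1 ler_pM2l // ler1n //.
Qed.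

Lemma chain_below_cvg k :
  eventually_equal (fun r => chain_event (fun c => below c (shrinking r)) k)
    (chain_event (fun c => at_zero c) k).
Proof.
move=> w.
have [e e0 He] := chain_below_at_zero t (@continuous_path w) y0.
exists (Num.truncn (y / e)).+1 => r Nr; split.
  apply: He; rewrite /shrinking ler_pdivrMr // mulrC -ler_pdivrMr //.
  apply: ltW; apply: lt_le_trans (truncnS_gt _) _.
  by rewrite ler_nat; apply: leq_trans Nr _.
apply: chain_sub => u; rewrite !unfold_in => /eqP u0; rewrite u0 normr0.
by have /andP[] := shrinking_itv r.
Qed.

Lemma measurable_chain_zero k : measurable (chain_event (fun c => at_zero c) k).
Proof.
apply: measurable_eventually (chain_below_cvg k) => r.
by have /andP[r0 ry] := shrinking_itv r; exact: measurable_chain_below.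
Qed.

Definition excursion_prob k := prob (chain_event (fun c => at_zero c) k).

Lemma excursion_prob_cvg0 : excursion_prob k @[k --> \oo] --> 0.
Proof.
have -> : 0 = prob (set0 : set T) by rewrite /prob measure0.
apply: cvg_prob; first exact: measurable_chain_zero.
move=> w; have [H noH] := chain_finite t (@continuous_path w) y0.
exists H.+1 => k Hk; split => // ch; apply: noH.
by apply: (chain_le _ ch); lia.
Qed.

Lemma prob_large_increment_cvg (e : R) : 0 < e ->
  prob [set w | ~~ all (fun s : R => `|s| <= e) (mkseq (fun i => increment n i w) (2 ^ n))]
    @[n --> \oo] --> 0.
Proof.
move=> e0; have -> : 0 = prob (set0 : set T) by rewrite /prob measure0.
apply: cvg_prob => [n|w]; first exact: (measurable_large_step (measurable_increment n)).
have [N HN] := grid_increments_small (@continuous_path w) t0 e0.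
by exists N => n /HN; rewrite grid_incrementsE => Hn; split => //=; rewrite Hn.
Qed.

(** By reflection, the probability that B reaches c before t, for c >= 0. *)
Definition tail_prob (c : R) : R := 2 * (1 - std_normal_cdf (c / Num.sqrt t)).

Lemma mean_below_cvg h H (e : R) : 0 < e -> e <= y ->
  \sum_(1 <= k < H.+1) binomial_tail_step 2^-1 h.+1 k * prob (grid_event e n k)
    @[n --> \oo] -->
  \sum_(1 <= k < H.+1) binomial_tail_step 2^-1 h.+1 k *
    prob (chain_event (fun c => below c e) k).
Proof.
move=> e0 ey.
apply: cvg_sum_seq => k; apply: cvgMl_tmp.
by apply: cvg_prob; [move=> n; exact: measurable_grid_event|exact: grid_event_cvg].
Qed.

Lemma mean_below_upper h H (e : R) : 0 < e -> e <= y ->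
  \sum_(1 <= k < H.+1) binomial_tail_step 2^-1 h.+1 k *
      prob (chain_event (fun c => below c e) k) <=
  tail_prob ((2 * h%:R + 1) * y - 2 * H%:R * e).
Proof.
move=> e0 ey.
have L := @mean_below_cvg h H e e0 ey; have L0 := prob_large_increment_cvg e0.
have : tail_prob ((2 * h%:R + 1) * y - 2 * H%:R * e) +
  prob [set w | ~~ all (fun s : R => `|s| <= e) (mkseq (fun i => increment n i w) (2 ^ n))]
    @[n --> \oo] --> tail_prob ((2 * h%:R + 1) * y - 2 * H%:R * e) + 0.
  by apply: cvgD => //; exact: cvg_cst.
rewrite addr0 => L1; apply: (ler_cvg_to L L1); apply: nearW => n.
have := @mean_count_upper _ _ _ P (increment n) (measurable_increment n)
   (independent_increments n) (@symmetric_increments n) (2 ^ n) y e h H e0 ey.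
rewrite /tail_prob -prob_endpoint => /le_trans; apply.
by under eq_set do rewrite sum_increments.
Qed.

Lemma mean_below_lower h H (e : R) : 0 < e -> e <= y ->
  tail_prob ((2 * h%:R + 1) * y + (2 * H%:R + 2) * e) <=
  \sum_(1 <= k < H.+1) binomial_tail_step 2^-1 h.+1 k *
      prob (chain_event (fun c => below c e) k) +
  prob (chain_event (fun c => below c e) H).
Proof.
move=> e0 ey.
have L := @mean_below_cvg h H e e0 ey; have L0 := prob_large_increment_cvg e0.
have LH : prob (grid_event e n H) @[n --> \oo] --> prob (chain_event (fun c => below c e) H).
  by apply: cvg_prob; [move=> n; exact: measurable_grid_event|exact: grid_event_cvg].
have L2 : 2 * prob [set w | ~~ all (fun s : R => `|s| <= e)
    (mkseq (fun i => increment n i w) (2 ^ n))] @[n --> \oo] --> 0.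
  by rewrite -[X in _ --> X](mulr0 2); exact: cvgMl_tmp.
have L1 : \sum_(1 <= k < H.+1) binomial_tail_step 2^-1 h.+1 k * prob (grid_event e n k) +
    prob (grid_event e n H) + 2 * prob [set w | ~~ all (fun s : R => `|s| <= e)
    (mkseq (fun i => increment n i w) (2 ^ n))] @[n --> \oo] -->
    \sum_(1 <= k < H.+1) binomial_tail_step 2^-1 h.+1 k *
      prob (chain_event (fun c => below c e) k) +
    prob (chain_event (fun c => below c e) H).
  rewrite -[X in _ --> X]addr0; apply: cvgD; last exact: L2.
  by apply: cvgD; [exact: L|exact: LH].
have Lc : (fun=> tail_prob ((2 * h%:R + 1) * y + (2 * H%:R + 2) * e)) @ \oo -->
    tail_prob ((2 * h%:R + 1) * y + (2 * H%:R + 2) * e) by exact: cvg_cst.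
apply: (ler_cvg_to Lc L1); apply: nearW => n /=.
have := @mean_count_lower _ _ _ P (increment n) (measurable_increment n)
   (independent_increments n) (@symmetric_increments n) (2 ^ n) y e h H e0 ey.
rewrite /tail_prob -prob_endpoint; apply: le_trans.
by under [X in _ <= 2 * prob X]eq_set do rewrite sum_increments.
Qed.

Lemma tail_prob_lipschitz (a b : R) :
  `|tail_prob a - tail_prob b| <= 2 * normal_peak 1 / Num.sqrt t * `|a - b|.
Proof.
rewrite /tail_prob -mulrBr normrM ger0_norm // -!mulrA ler_pM2l //.
set x := std_normal_cdf _; set z := std_normal_cdf _.
rewrite (_ : 1 - x - (1 - z) = z - x); last ring.
rewrite distrC; apply: le_trans (std_normal_cdf_lipschitz _ _) _.
by rewrite -mulrBl normrM (@ger0_norm _ (Num.sqrt t)^-1) ?invr_ge0 ?sqrtr_ge0 // mulrCA mulrC mulrA.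
Qed.

Lemma shrinking_cvg0 : shrinking r @[r --> \oo] --> 0.
Proof.
rewrite -[X in _ --> X](mulr0 y); apply: cvgMl_tmp; exact: cvg_harmonic.
Qed.

Lemma tail_prob_cvg (u : nat -> R) l :
  u r @[r --> \oo] --> l -> tail_prob (u r) @[r --> \oo] --> tail_prob l.
Proof.
move=> ul; pose K := 2 * normal_peak 1 / Num.sqrt t.
have K0 : (fun r => K * `|l - u r|) @ \oo --> 0.
  rewrite -[X in _ --> X](mulr0 K) -[X in K * X](@normr0 _ R) -(subrr l).
  by apply: cvgMl_tmp; apply: cvg_norm; apply: cvgB => //; exact: cvg_cst.
apply/cvgrPdist_lt => e e0.
have /cvgrPdist_lt/(_ e e0) := K0; apply: filterS => r.
rewrite sub0r normrN => small; apply: le_lt_trans (tail_prob_lipschitz _ _) _.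
by apply: le_lt_trans small; exact: ler_norm.
Qed.

Lemma tail_prob_shrinking_cvg a c :
  tail_prob (a + c * shrinking r) @[r --> \oo] --> tail_prob a.
Proof.
apply: tail_prob_cvg; rewrite -[X in _ --> X]addr0 -[X in _ + X](mulr0 c).
apply: cvgD; first exact: cvg_cst.
by apply: cvgMl_tmp; exact: shrinking_cvg0.
Qed.

(** The estimates on the grid, passed to the limit in the mesh and then in e. *)
Lemma mean_excursions h H :
  \sum_(1 <= k < H.+1) binomial_tail_step 2^-1 h.+1 k * excursion_prob k <=
  tail_prob ((2 * h%:R + 1) * y) <=
  \sum_(1 <= k < H.+1) binomial_tail_step 2^-1 h.+1 k * excursion_prob k + excursion_prob H.
Proof.
have L k : prob (chain_event (fun c => below c (shrinking r)) k) @[r --> \oo] --> excursion_prob k.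
  apply: cvg_prob; last exact: chain_below_cvg.
  by move=> r; have /andP[r0 ry] := shrinking_itv r; exact: measurable_chain_below.
have LS : (\sum_(1 <= k < H.+1) binomial_tail_step 2^-1 h.+1 k *
     prob (chain_event (fun c => below c (shrinking r)) k)) @[r --> \oo] -->
   \sum_(1 <= k < H.+1) binomial_tail_step 2^-1 h.+1 k * excursion_prob k.
  by apply: cvg_sum_seq => k; apply: cvgMl_tmp; exact: L.
apply/andP; split.
  apply: (ler_cvg_to LS (@tail_prob_shrinking_cvg _ (- (2 * H%:R)))); apply: nearW => r.
  have /andP[r0 ry] := shrinking_itv r.
  by have := mean_below_upper h H r0 ry; rewrite mulNr.
apply: (ler_cvg_to (@tail_prob_shrinking_cvg _ (2 * H%:R + 2)) (cvgD LS (L H))); apply: nearW => r.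
have /andP[r0 ry] := shrinking_itv r; exact: mean_below_lower.
Qed.

End BrownianExcursions.

(** * Skew Brownian motion *)

Lemma count_iota_eventually (Q : pred nat) k : exists N, forall n, (N <= n)%N ->
  (k <= count Q (iota 0 n))%N <->
  exists ms : seq nat, [/\ uniq ms, size ms = k & {in ms, forall m, Q m}].
Proof.
have to_ms n : (k <= count Q (iota 0 n))%N ->
    exists ms : seq nat, [/\ uniq ms, size ms = k & {in ms, forall m, Q m}].
  rewrite -size_filter => kn; exists (take k [seq m <- iota 0 n | Q m]); split.
  - by rewrite take_uniq // filter_uniq // iota_uniq.
  - by rewrite size_takel.
  - by move=> m /mem_take; rewrite mem_filter => /andP[].
case: (pselect (exists ms : seq nat, [/\ uniq ms, size ms = k & {in ms, forall m, Q m}])) => [ex|no].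
  have [ms [ums <- Qms]] := ex; exists (\max_(m <- ms) m).+1 => n Nn; split; last first.
    move=> _; rewrite -size_filter; apply: uniq_leq_size => // m mms.
    rewrite mem_filter Qms // mem_iota /= add0n; apply: leq_trans Nn.
    by rewrite ltnS; exact: (@leq_bigmax_seq _ ms xpredT id m mms isT).
  by move=> _; exists ms.
by exists 0%N => n _; split => // /to_ms.
Qed.

Section SkewExcursions.
Context d (T : measurableType d) (R : realType) (P : probability T R).
Variables (B : R -> {RV P >-> R}) (J : nat -> T -> set R) (A : nat -> {RV P >-> R}).
Variables (alpha t y : R).
Hypotheses (hB : standard_brownian_motion B) (hJ : excursion_enumeration B J).
Hypotheses (hA : excursion_signs alpha B A).
Hypotheses (t0 : 0 < t) (y0 : 0 < y).
Local Notation prob := (prob P).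
Local Notation path := (extended_path B).

Definition large m w : Prop := large_excursions (B ^~ w) (J ^~ w) t y m.
Definition largeb m w : bool := `[< large m w >].

Let G := \bigcup_(i in (`[0, +oo[%classic : set R)) preimage_set_system setT (B i) measurable.

Lemma brownian_generated_sub : G `<=` measurable.
Proof.
move=> X [i _ [C mC <-]]; rewrite setTI -[X in measurable X]setTI.
exact: (measurable_funP (B i)).
Qed.

(** Around a time at which |B| > y, the path stays above y, hence in the same
    excursion, so that a grid time can be found. This makes the event measurable
    with respect to B. *)
Lemma large_on_grid m w : large m w <->
  exists n i, [/\ (i <= 2 ^ n)%N, J m w (grid_time t n i) & y < `|B (grid_time t n i) w|].
Proof.
have enumJ := exc_enumerates hJ w.
split; last first.
  by move=> [n [i [i2 Ji yi]]]; exists (grid_time t n i); split => //; exact: grid_time_itv.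
move=> [s [Js /andP[s0 st] ys]].
have [h h0 hH] := common_modulus y (continuous_path hB (w := w)) 1 [:: s].
have [N HN] := grid_step_small t h0.
have small := HN N (leqnn N).
have /andP[u1 u2] := round_down_itv t0 N s0.
have near_s r : round_down t N s <= r <= s -> y < `|path w r|.
  move=> /andP[ur rs]; have /(hH s) := mem_head s [::] => /(_ r).
  have sr : `|s - r| < h by rewrite ger0_norm ?subr_ge0 //; lra.
  by move=> /(_ sr) [H _]; apply: H; rewrite /above extended_pathE.
have v0 : 0 <= round_down t N s by rewrite /round_down; exact: grid_time_ge0.
have nz r : round_down t N s <= r <= s -> B r w != 0.
  move=> rs; have := near_s r rs; rewrite extended_pathE; last by case/andP: rs; lra.
  by move=> yr; rewrite -normr_gt0; exact: lt_trans yr.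
have vB : B (round_down t N s) w != 0 by apply: nz; rewrite lexx u2.
have [m' Jm'] := excursion_cover enumJ v0 vB.
have Jm's := excursion_extend enumJ Jm' u2 nz.
have mm' := excursion_disjoint enumJ Js Jm's.
exists N, (Num.truncn (s * 2 ^+ N / t)); split.
- rewrite -(ler_nat R) natrX; have x0 : 0 <= s * 2 ^+ N / t.
    by rewrite divr_ge0 ?mulr_ge0 ?exprn_ge0 // ltW.
  have /andP[H _] := truncn_itv x0; apply: le_trans H _.
  by rewrite ler_pdivrMr // mulrC ler_pM2l ?exprn_gt0.
- by rewrite mm'.
- rewrite -(extended_pathE B w v0); apply: near_s; by rewrite lexx u2.
Qed.

Lemma large_generated m : <<s G >> [set w | largeb m w].
Proof.
rewrite (_ : [set w | _] = \bigcup_n \bigcup_(i in [set` iota 0 (2 ^ n).+1])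
   ([set w | J m w (grid_time t n i)] `&` [set w | y < `|B (grid_time t n i) w|])); last first.
  apply/seteqP; split => w.
    move=> /asboolP/large_on_grid [n [i [i2 Ji yi]]]; exists n => //; exists i => //.
    suff : i \in iota 0 (2 ^ n).+1 by [].
    by rewrite mem_iota add0n ltnS.
  move=> [n _ [i Hi [Ji yi]]].
  have i2 : (i <= 2 ^ n)%N.
    have : i \in iota 0 (2 ^ n).+1 by exact: Hi.
    by rewrite mem_iota add0n ltnS.
  by apply/asboolP/large_on_grid; exists n, i.
apply: (@bigcupT_measurable _ (g_sigma_algebraType G)) => n.
apply: (@fin_bigcup_measurable _ (g_sigma_algebraType G)) => [|i _]; first exact: finite_seq.
apply: (@measurableI _ (g_sigma_algebraType G)).
  exact: (exc_measurable hJ m (grid_time_ge0 t0 n i)).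
apply: sub_sigma_algebra; exists (grid_time t n i).
  by rewrite /= in_itv /= andbT grid_time_ge0.
exists [set x | far y x]; first exact: measurable_far.
by rewrite setTI.
Qed.

Lemma measurable_large m : measurable [set w | largeb m w].
Proof.
have : <<s G >> `<=` measurable.
  apply: smallest_sub; [exact: sigma_algebra_measurable|exact: brownian_generated_sub].
by apply; exact: large_generated.
Qed.

Let selected_event n k : set T := [set w | (k <= count (largeb ^~ w) (iota 0 n))%N].

Lemma measurable_selected n k : measurable (selected_event n k).
Proof. by apply: measurable_count => m _; exact: measurable_large. Qed.

Lemma selected_cvg k :
  eventually_equal (fun n => selected_event n k) (chain_event B t y (fun c => at_zero c) k).
Proof.
move=> w; case: k => [|k].
  by exists 0%N => n _; split => // _; exists [::].
have [N HN] := count_iota_eventually (largeb ^~ w) k.+1.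
exists N => n /HN Hn; rewrite /selected_event /= Hn.
rewrite /chain_event /= -(large_excursions_chain t (extended_pathE B w) y0 (exc_enumerates hJ w)).
split => -[ms [ums sms H]]; exists ms; split => // m /H.
  by move/asboolP.
by move=> ?; apply/asboolP.
Qed.

Let positive_event n j : set T :=
  [set w | (j < count (fun m => largeb m w && heads A m w) (iota 0 n))%N].

Lemma positive_event_cvg (M : nat -> T -> R) j :
  (forall w, ranked_excursion_heights
     (fun s => skew_brownian_motion B J A s w) (J ^~ w) t (M ^~ w)) ->
  eventually_equal (fun n => positive_event n j) [set w | y < M j.+1 w].
Proof.
move=> hM w.
have [N HN] := count_iota_eventually (fun m => largeb m w && heads A m w) j.+1.
exists N => n /HN Hn; rewrite /positive_event /= Hn.
have := ranked_height_gt (continuous_path hB (w := w)) (extended_pathE B w) t0 (ltW y0)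
  (sign_values hA ^~ w) (exc_enumerates hJ w) (ltn0Sn j) (hM w).
move=> ->; split => -[ms [ums sms H]]; exists ms; split => // m /H.
  by move=> /andP[/asboolP ? /eqP ?].
by move=> [? ?]; apply/andP; split; [apply/asboolP|apply/eqP].
Qed.

Lemma prob_positive_event n j : prob (positive_event n j) =
  \sum_(1 <= k < n.+1) binomial_tail_step alpha j.+1 k * prob (selected_event n k).
Proof.
apply: (@thinned_count _ T R P alpha (fun m => A m : T -> R) _ _ _ G largeb n _ _ _ j).
- by move=> m; exact: measurable_funP.
- exact: (sign_prob hA).
- exact: (sign_independent hA).
- exact: brownian_generated_sub.
- exact: (sign_independent_bm hA).
- exact: large_generated.
Qed.

Lemma measurable_positive_event n j : measurable (positive_event n j).
Proof.
apply: measurable_count => m _.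
rewrite (_ : [set w | _] = [set w | largeb m w] `&` [set w | heads A m w]).
  apply: measurableI; first exact: measurable_large.
  by apply: measurable_heads => k; exact: measurable_funP.
by apply/seteqP; split => w /= => [/andP[]|[-> ->]].
Qed.

Hypotheses (alpha0 : 0 < alpha) (alpha1 : alpha < 1).
Local Notation p := (excursion_prob B t y).

(** Only the indices m < n are first considered, so that the set of selected
    indices takes finitely many values; n then tends to infinity. The terms with
    k > H contribute at most p H, since the steps of a tail add up to at most 1. *)
Lemma rank_prob_bounds (M : nat -> T -> R) j H :
  (forall w, ranked_excursion_heights
     (fun s => skew_brownian_motion B J A s w) (J ^~ w) t (M ^~ w)) ->
  \sum_(1 <= k < H.+1) binomial_tail_step alpha j.+1 k * p k <=
    prob [set w | y < M j.+1 w] <=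
  \sum_(1 <= k < H.+1) binomial_tail_step alpha j.+1 k * p k + p H.
Proof.
move=> hM.
have a0 := ltW alpha0; have a1 := ltW alpha1.
have step0 k : 0 <= binomial_tail_step alpha j.+1 k by exact: binomial_tail_step_ge0.
have Lk k : prob (selected_event n k) @[n --> \oo] --> p k.
  by apply: cvg_prob; [move=> n; exact: measurable_selected|exact: selected_cvg].
have LS : (\sum_(1 <= k < H.+1) binomial_tail_step alpha j.+1 k * prob (selected_event n k))
    @[n --> \oo] --> \sum_(1 <= k < H.+1) binomial_tail_step alpha j.+1 k * p k.
  by apply: cvg_sum_seq => k; apply: cvgMl_tmp; exact: Lk.
have LM : prob (positive_event n j) @[n --> \oo] --> prob [set w | y < M j.+1 w].
  apply: cvg_prob; first by move=> n; exact: measurable_positive_event.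
  exact: positive_event_cvg.
have split_sum n : (H <= n)%N -> prob (positive_event n j) =
    \sum_(1 <= k < H.+1) binomial_tail_step alpha j.+1 k * prob (selected_event n k) +
    \sum_(H.+1 <= k < n.+1) binomial_tail_step alpha j.+1 k * prob (selected_event n k).
  by move=> Hn; rewrite prob_positive_event (big_cat_nat (n := H.+1)).
apply/andP; split.
  apply: (ler_cvg_to LS LM); exists H => // n /= Hn.
  rewrite (split_sum n Hn) lerDl; apply: sumr_ge0 => k _.
  by rewrite mulr_ge0 // prob_ge0.
apply: (ler_cvg_to LM (cvgD LS (Lk H))); exists H => // n /= Hn.
rewrite (split_sum n Hn) lerD2l.
apply: (@le_trans _ _ (\sum_(H.+1 <= k < n.+1) binomial_tail_step alpha j.+1 k * prob (selected_event n H))).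
  rewrite !big_nat; apply: ler_sum => k /andP[Hk _]; rewrite ler_wpM2l //.
  apply: le_prob; [exact: measurable_selected|exact: measurable_selected|].
  by move=> w; rewrite /selected_event /=; apply: leq_trans; exact: ltnW.
rewrite -mulr_suml ler_piMl ?prob_ge0 //.
have /andP[_] := @binomial_tail_bound R alpha j.+1 n a0 a1.
rewrite binomial_tail_sum (big_cat_nat (n := H.+1)) //=; apply: le_trans.
by rewrite lerDr; apply: sumr_ge0.
Qed.

(** The bound rho does not depend on y. *)
Lemma rank_prob_approx (M : nat -> T -> R) j N rho :
  (forall w, ranked_excursion_heights
     (fun s => skew_brownian_motion B J A s w) (J ^~ w) t (M ^~ w)) ->
  (0 < N)%N ->
  (forall H, \sum_(N <= h < H) `|thinning_coef alpha j.+1 h| <= rho) ->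
  `|prob [set w | y < M j.+1 w] -
    \sum_(1 <= h < N) thinning_coef alpha j.+1 h * tail_prob t ((2 * h%:R - 1) * y)| <= rho.
Proof.
move=> hM N0 Hrho.
apply: (@thinned_series_bound R alpha j p) => //.
- exact: ltW.
- exact: ltW.
- move=> k; rewrite prob_ge0 prob_le1 //; exact: measurable_chain_zero.
- move=> h H; rewrite (_ : 2 * h.+1%:R - 1 = 2 * h%:R + 1) ?mean_excursions //.
  by rewrite -natr1; ring.
- by move=> H; exact: rank_prob_bounds.
- exact: excursion_prob_cvg0.
Qed.

Lemma measurable_rank (M : nat -> T -> R) j :
  (forall w, ranked_excursion_heights
     (fun s => skew_brownian_motion B J A s w) (J ^~ w) t (M ^~ w)) ->
  measurable [set w | y < M j.+1 w].
Proof.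
move=> hM; apply: measurable_eventually (@positive_event_cvg M j hM) => n.
exact: measurable_positive_event.
Qed.

End SkewExcursions.

Unset Implicit Arguments.

Theorem theorem2p1 (R : realType) (d : measure_display) (T : measurableType d)
    (P : probability T R) (alpha : R)
    (B : R -> {RV P >-> R}) (J : nat -> T -> set R) (A : nat -> {RV P >-> R})
    (t y : R) (M : nat -> T -> R)
    (halpha0 : 0 < alpha) (halpha1 : alpha < 1)
    (hB : standard_brownian_motion B)
    (hJ : excursion_enumeration B J)
    (hA : excursion_signs alpha B A)
    (ht : 0 < t) (hy : 0 <= y)
    (hM : forall w, ranked_excursion_heights
            (fun s => skew_brownian_motion B J A s w) (J ^~ w) t (M ^~ w))
    (j : nat) (hj : (1 <= j)%N) :
  (fun n : nat =>
     (\sum_(1 <= h < n)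
        2 * 'C(h.-1, j.-1)%:R * (1 - 2 * alpha) ^+ (h - j) * (2 * alpha) ^+ j
          * (1 - std_normal_cdf ((2 * h%:R - 1) * y / Num.sqrt t)))%:E)
    @ \oo --> P [set w | y < M j w].
Proof.
case: j hj => // j _.
have [rho [rho0 Hrho]] := thinning_coef_summable j halpha0 halpha1.
(* Positive levels decreasing to y, which may be 0. *)
pose level r : R := y + r.+1%:R^-1.
have level0 r : 0 < level r by rewrite /level ltr_wpDl // invr_gt0.
have level_y r : y < level r by rewrite /level ltrDl invr_gt0.
have cvg_level : level r @[r --> \oo] --> y.
  by rewrite -[X in _ --> X]addr0; apply: cvgD; [exact: cvg_cst|exact: cvg_harmonic].
have level_event : eventually_equal (fun r => [set w | level r < M j.+1 w]) [set w | y < M j.+1 w].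
  move=> w; have [yM|My] := ltP y (M j.+1 w).
    exists (Num.truncn (M j.+1 w - y)^-1).+1 => r Nr /=; split => // _.
    rewrite /level -ltrBrDl invf_plt ?posrE ?subr_gt0 //.
    apply: lt_le_trans (truncnS_gt _) _; rewrite ler_nat; exact: leq_trans Nr _.
  exists 0%N => r _ /=; split => //; first by move=> H; exact: lt_trans H.
  by rewrite ltNge My.
have mr r : measurable [set w | level r < M j.+1 w].
  exact: (measurable_rank hB hJ hA ht (level0 r) j hM).
have mM : measurable [set w | y < M j.+1 w] := measurable_eventually mr level_event.
pose S n z := \sum_(1 <= h < n) thinning_coef alpha j.+1 h * tail_prob t ((2 * h%:R - 1) * z).
have cvgS n : S n (level r) @[r --> \oo] --> S n y.
  apply: cvg_sum_seq => h; apply: cvgMl_tmp; apply: tail_prob_cvg.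
  exact: cvgMl_tmp.
have bound n : (0 < n)%N -> `|prob P [set w | y < M j.+1 w] - S n y| <= rho n.
  move=> n0.
  have L : `|prob P [set w | level r < M j.+1 w] - S n (level r)| @[r --> \oo] -->
      `|prob P [set w | y < M j.+1 w] - S n y|.
    by apply: cvg_norm; apply: cvgB; [exact: cvg_prob|exact: cvgS].
  apply: (ler_cvg_to L (cvg_cst (rho n))); apply: nearW => r.
  exact: (rank_prob_approx hB hJ hA ht (level0 r) halpha0 halpha1 hM n0 (Hrho n)).
rewrite probE //.
have -> : (fun n => (\sum_(1 <= h < n)
        2 * 'C(h.-1, j.+1.-1)%:R * (1 - 2 * alpha) ^+ (h - j.+1) * (2 * alpha) ^+ j.+1
          * (1 - std_normal_cdf ((2 * h%:R - 1) * y / Num.sqrt t)))%:E) =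
    (fun n => (S n y)%:E).
  apply/funext => n; congr (_%:E); apply: eq_bigr => h _.
  by rewrite /thinning_coef /tail_prob; ring.
apply: cvg_EFin; first by apply: nearW.
apply/cvgrPdist_le => e e0.
have /cvgrPdist_le/(_ e e0) [N _ HN] := rho0.
exists (maxn N 1) => // n /=; rewrite geq_max => /andP[Nn n1].
apply: le_trans (bound n n1) _; apply: le_trans (ler_norm _) _.
by have := HN n Nn; rewrite sub0r normrN.
Qed.
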